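(* Let $\mathcal M$ denote the set of Morse-like functions on $[0,1]$ with local minima at $x=0$ and $x=1$, modulo graph-equivalence. Let $\mathcal X$ denote the set of isomorphism classes of chiral merge trees. Then the map $\Psi:\mathcal M\to\mathcal X$ sending the class of $f$ to the isomorphism class of the chiral merge tree of $f$ is a bijection onto its image.
   Context: **Functions.** Two continuous $f,g:[0,1]\to\mathbb{R}$ are graph-equivalent if there is an orientation-preserving homeomorphism $\phi:[0,1]\to[0,1]$ with $f=g\circ\phi$. A critical point of $f$ is a point $p\in[0,1]$ that is a local minimum or a local maximum, i.e. there is an open neighborhood $U$ of $p$ in $[0,1]$ with $f(p)\le f(x)$ for all $x\in U$, or $f(p)\ge f(x)$ for all $x\in U$. A continuous $f$ is Morse-like if it is graph-equivalent to a piecewise-linear function all of whose critical points are isolated and have pairwise distinct critical values (so its graph consists of finitely many segments of nonzero slope). **Merge trees.** A merge tree is a connected, locally finite, contractible one-dimensional cell complex $T$ with a distinguished edge $e_\infty$ without compact closure, such that $T\setminus e_\infty$ is a compact tree rooted at $v_\infty$, the one vertex incident to $e_\infty$, together with a continuous map $\pi:T\to\mathbb{R}$ such that $\pi(e_\infty)=(\pi(v_\infty),\infty)$ and, for every injective path $\gamma:[0,1]\to T$ from a vertex to $v_\infty$, $\pi\circ\gamma$ is (strictly) increasing. A child of a vertex $v$ is a vertex $w$ joined to $v$ by an edge with $\pi(w)<\pi(v)$. Merge trees are isomorphic if there is a homeomorphism between them commuting with the maps to $\mathbb{R}$ (vertices that merely subdivide an edge are irrelevant and may be removed). **Chiral merge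 trees.** A chiral merge tree is a merge tree in which every non-leaf vertex has exactly two children, together with, for each such vertex, a labelling of the two edges to its children, one by $L$ (left), the other by $R$ (right). Isomorphisms are isomorphisms of merge trees preserving the labels. **Chiral merge tree of a function.** For Morse-like $f$, let $T_f=\{(x,t)\in[0,1]\times\mathbb{R}: f(x)\le t\}/\!\sim$, where $(x,t)\sim(x',t')$ iff $t=t'$ and $x,x'$ lie in the same path component of $f^{-1}(-\infty,t]$, with $\pi[(x,t)]=t$. After removing subdividing vertices, each non-leaf vertex is a place where exactly two components (intervals) merge; label $L$ the edge corresponding to the interval lying to the left in $[0,1]$ and $R$ the other. *)

(* Defs.v *)
From HB Require Import structures.
Set Warnings "-all".
From mathcomp Require Import all_boot all_order all_algebra.
From mathcomp Require Import generic_quotient.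
From mathcomp Require Import all_classical all_reals all_analysis.
Import Order.TTheory GRing.Theory Num.Theory.
Import numFieldNormedType.Exports.

Set Implicit Arguments.
Unset Strict Implicit.
Unset Printing Implicit Defensive.

Local Open Scope classical_set_scope.
Local Open Scope ring_scope.
Local Open Scope quotient_scope.

(* Sets used as types carry the subspace topology (`set_type`). *)

Definition unitI (R : realType) : set R := `[0, 1].
Arguments unitI R : clear implicits.

Fact unitI0_subproof (R : realType) : (0 : R) \in unitI R.
Proof. by apply/mem_set; rewrite /unitI /= in_itv /= lexx ler01. Qed.

Fact unitI1_subproof (R : realType) : (1 : R) \in unitI R.
Proof. by apply/mem_set; rewrite /unitI /= in_itv /= lexx ler01. Qed.

Definition I0 {R : realType} : unitI R := exist _ 0 (unitI0_subproof R).
Definition I1 {R : realType} : unitI R := exist _ 1 (unitI1_subproof R).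

Definition halfline (R : realType) : set R := `[0, +oo[.
Arguments halfline R : clear implicits.

Fact halfline0_subproof (R : realType) : (0 : R) \in halfline R.
Proof. by apply/mem_set; rewrite /halfline /= in_itv /= lexx. Qed.

Definition H0 {R : realType} : halfline R := exist _ 0 (halfline0_subproof R).

Definition homeomorphism (T U : topologicalType) (h : T -> U) :=
  exists k : U -> T, [/\ continuous h, continuous k, cancel h k & cancel k h].

(* Existence of a path from x to y inside A, i.e. x and y are in the same path
   component of A. *)
Definition path_joined (R : realType) (T : topologicalType) (A : set T)
    (x y : T) :=
  exists g : unitI R -> T,
    [/\ continuous g, g I0 = x, g I1 = y & forall s, A (g s)].

Definition contractible (R : realType) (T : topologicalType) :=
  exists (H : unitI R * T -> T) (x0 : T),
    [/\ continuous H, forall x, H (I0, x) = x & forall x, H (I1, x) = x0].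

(* Quotient of { x | A x } by E. Predicates are written T -> Prop rather than
   `set T` because the universe of `set` is too small for T the type of all
   chiral merge trees. *)
Definition eqclass (T : Type) (A : T -> Prop) (E : T -> T -> Prop) (x : T) :
  T -> Prop := fun y => A y /\ E x y.

Definition classes (T : Type) (A : T -> Prop) (E : T -> T -> Prop)
  (C : T -> Prop) : Prop := exists2 x, A x & C = eqclass A E x.

Section functions.
Variable R : realType.
Implicit Types f g : unitI R -> R.

Definition graph_equiv f g :=
  exists phi : unitI R -> unitI R,
    [/\ homeomorphism phi,
        {homo phi : x y / val x < val y} &
        f = g \o phi].

Definition local_min f (p : unitI R) := \forall x \near p, f p <= f x.
Definition local_max f (p : unitI R) := \forall x \near p, f x <= f p.
Definition critical f : set (unitI R) :=
  [set p | local_min f p \/ local_max f p].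

Definition piecewise_linear g :=
  exists s : seq R, itv_partition 0 1 s /\
    forall i, (i < size s)%N -> exists a b : R, forall x : unitI R,
      nth 0 (0 :: s) i <= val x <= nth 0 (0 :: s) i.+1 -> g x = a * val x + b.

Definition morse_like f :=
  continuous f /\
  exists g, [/\ graph_equiv f g, piecewise_linear g,
    forall p, critical g p -> isolated (critical g) p &
    forall p q, critical g p -> critical g q -> p <> q -> g p <> g q].

Definition admissible f := [/\ morse_like f, local_min f I0 & local_min f I1].

Definition function_class f := eqclass admissible graph_equiv f.

Definition Mset := classes admissible graph_equiv.

End functions.

Section cells.
Variables (R : realType) (T : topologicalType) (V : set T).

Definition segment_edge (e : set T) :=
  exists phi : unitI R -> T,
    [/\ continuous phi, V (phi I0), V (phi I1),
        {in [pred s | 0 < val s < 1] &, injective phi} &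
        phi @` [set s | 0 < val s < 1] = e].

(* A one-cell with one end attached to a vertex and whose other end leaves every
   compact set: the characteristic map is a closed embedding of [0, +oo[. *)
Definition ray_edge (e : set T) :=
  exists phi : halfline R -> T,
    [/\ continuous phi, injective phi,
        forall C, closed C -> closed (phi @` C), V (phi H0) &
        phi @` [set s | 0 < val s] = e].

Definition cells (E : set (set T)) : set (set T) :=
  [set [set v] | v in V] `|` E.

(* For a locally finite family of cells in a Hausdorff space, closure finiteness
   and the weak topology follow from the existence of characteristic maps. *)
Definition locally_finite_1complex (E : set (set T)) :=
  [/\ hausdorff_space T,
      partition (cells E) id setT,
      forall e, E e -> segment_edge e \/ ray_edge e &
      forall x : T, exists2 U, nbhs x U &
        finite_set [set c | cells E c /\ c `&` U !=set0]].

End cells.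

Record merge_data (R : realType) := MergeData {
  carrier :> topologicalType;
  vertices : set carrier;
  edges : set (set carrier);
  einf : set carrier;
  height : carrier -> R }.

Arguments vertices {R} m.
Arguments edges {R} m.
Arguments einf {R} m.
Arguments height {R m}.

Definition is_merge_tree (R : realType) (T : merge_data R) :=
  [/\ locally_finite_1complex R (vertices T) (edges T),
      connected [set: T] /\ contractible R T,
      [/\ edges T (einf T), ~ compact (closure (einf T)),
          compact (~` einf T), connected (~` einf T) &
          contractible R (set_type (~` einf T))],
      continuous (height : T -> R) &
      exists v : T,
        [/\ vertices T v, closure (einf T) `&` vertices T = [set v],
            height @` einf T = `]height v, +oo[%classic &
            forall g : unitI R -> T, continuous g -> injective g ->
              vertices T (g I0) -> g I1 = v ->
              {homo height \o g : s t / val s < val t >-> s < t}]].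

Section children.
Variables (R : realType) (T : merge_data R).

Definition ends (e : set T) : set T := closure e `\` e.

Definition children (v : T) : set T :=
  [set w | [/\ vertices T w, height w < height v &
               exists2 e, edges T e & ends e = [set v; w]]].

Definition child_edges (v : T) : set (set T) :=
  [set e | edges T e /\ exists2 w, children v w & ends e = [set v; w]].

End children.

Inductive side := Left | Right.

Record chiral_data (R : realType) := ChiralData {
  merge_part :> merge_data R;
  label : merge_part -> set merge_part -> side }.

Arguments label {R c}.

(* `label v e` only matters when e is one of the two edges from v to its
   children. *)
Definition is_chiral_merge_tree (R : realType) (T : chiral_data R) :=
  is_merge_tree T /\
  forall v : T, vertices T v -> children v !=set0 ->
    (exists w1 w2, w1 <> w2 /\ children v = [set w1; w2]) /\
    (exists eL eR, [/\ child_edges v = [set eL; eR],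
                       label v eL = Left & label v eR = Right]).

(* h need not be assumed to preserve vertices and edges: in a chiral merge tree
   no vertex subdivides an edge, so the cell structure is determined by the
   topology. *)
Definition chiral_iso (R : realType) (T U : chiral_data R) :=
  exists h : T -> U,
    [/\ homeomorphism h,
        forall x, height (h x) = height x &
        forall v e, vertices T v -> child_edges v e ->
          label (h v) (h @` e) = label v e].

Definition iso_class (R : realType) (T : chiral_data R) :=
  eqclass (@is_chiral_merge_tree R) (@chiral_iso R) T.

Definition Xset (R : realType) :=
  classes (@is_chiral_merge_tree R) (@chiral_iso R).

Section path_joined_equivalence.
Variables (R : realType) (T : topologicalType) (A : set T).

Fact clampI_subproof (r : R) : Num.max 0 (Num.min r 1) \in unitI R.
Proof.
apply/mem_set; rewrite /unitI /= in_itv /= le_max lexx /=.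
by rewrite ge_max ler01 ge_min lexx orbT.
Qed.

Definition clampI (r : R) : unitI R :=
  exist _ (Num.max 0 (Num.min r 1)) (clampI_subproof r).

Lemma clampI0 : clampI 0 = I0.
Proof. by apply: val_inj; rewrite /= min_l ?ler01 // max_l. Qed.

Lemma clampI1 : clampI 1 = I1.
Proof. by apply: val_inj; rewrite /= min_l // max_r. Qed.

Lemma continuous_clampI : continuous clampI.
Proof.
apply: (continuous_comp_initial (w := set_val)).
apply: (@max_fun_continuous _ R R (cst 0) (fun r => Num.min r 1)).
  exact: cst_continuous.
apply: (@min_fun_continuous _ R R id (cst 1)); last exact: cst_continuous.
by move=> r; exact: cvg_id.
Qed.

Lemma path_joined_refl x : A x -> path_joined R A x x.
Proof. by move=> Ax; exists (cst x); split => //; exact: cst_continuous. Qed.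

Lemma path_joined_sym x y : path_joined R A x y -> path_joined R A y x.
Proof.
move=> [g [cg g0 g1 gA]]; exists (fun s => g (clampI (1 - val s))); split.
- move=> s; apply: (@continuous_comp (unitI R) (unitI R) T (fun s => clampI (1 - val s)) g);
    last exact: cg.
  apply: (@continuous_comp (unitI R) R (unitI R) (fun s => 1 - val s) clampI);
    last exact: continuous_clampI.
  apply: (@continuousB R R^o (unitI R) (fun=> 1) (fun s => val s) s).
    exact: cst_continuous.
  exact: initial_continuous.
- by rewrite /= subr0 clampI1.
- by rewrite /= subrr clampI0.
- by move=> s; exact: gA.
Qed.

Lemma path_joined_trans x y z :
  path_joined R A x y -> path_joined R A y z -> path_joined R A x z.
Proof.
move=> [g [cg g0 g1 gA]] [h [ch h0 h1 hA]].
have cc (k : unitI R -> T) (a b : R) : continuous k ->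
    continuous (fun r : R => k (clampI (a * r + b))).
  move=> ck r; apply: (@continuous_comp _ _ _ (fun r => clampI (a * r + b)) k);
    last exact: ck.
  apply: (@continuous_comp _ _ _ (fun r : R => a * r + b) clampI);
    last exact: continuous_clampI.
  by apply: cvgD; [apply: cvgM; [exact: cvg_cst|exact: cvg_id]|exact: cvg_cst].
pose p1 (r : R) := g (clampI (2 * r + 0)).
pose p2 (r : R) := h (clampI (2 * r + -1)).
pose p (r : R) := if r <= 2^-1 then p1 r else p2 r.
have half : (2 : R) * 2^-1 = 1 by rewrite divff.
have cp : continuous p.
  apply/continuous_subspace_setT.
  have -> : [set: R] = [set r | r <= 2^-1] `|` [set r | 2^-1 <= r].
    by apply/seteqP; split => // r _; case: (leP r 2^-1) => [|/ltW]; [left|right].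
  apply: withinU_continuous; [exact: closed_le|exact: closed_ge| |].
    apply: (@subspace_eq_continuous _ _ _ p1).
      by move=> r /set_mem r2; rewrite /p /from_subspace; case: ifP => //; move: r2 => /= ->.
    exact/continuous_subspaceT/cc.
  apply: (@subspace_eq_continuous _ _ _ p2).
    move=> r /set_mem /= r2; rewrite /p /from_subspace; case: ifPn => // r2'.
    have -> : r = 2^-1 by apply/eqP; rewrite eq_le r2' r2.
    rewrite /p1 /p2 half addr0 subrr.
    by rewrite clampI0 clampI1 g1 h0.
  exact/continuous_subspaceT/cc.
exists (fun s : unitI R => p (val s)); split.
- by move=> s; apply: continuous_comp; [exact: initial_continuous|exact: cp].
- by rewrite /p /= invr_ge0 ler0n /p1 mulr0 addr0 clampI0.
- rewrite /p /= ifF; last by apply/negbTE; rewrite -ltNge invf_lt1 ?ltr0n// ltr1n.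
  by rewrite /p2 mulr1 -[2]/(1 + 1) addrK clampI1.
- by move=> s; rewrite /p; case: (_ <= _); [exact: gA|exact: hA].
Qed.

End path_joined_equivalence.

Section tree_of_function.
Variables (R : realType) (f : unitI R -> R).

Definition epigraph : set (unitI R * R) := [set z | f z.1 <= z.2].

Definition sublevel (t : R) : set (unitI R) := [set x | f x <= t].

Definition merge_rel (z w : epigraph) : bool :=
  `[< (val z).2 = (val w).2 /\
      path_joined R (sublevel (val z).2) (val z).1 (val w).1 >].

Lemma merge_rel_refl : reflexive merge_rel.
Proof.
move=> z; apply/asboolP; split => //; apply: path_joined_refl.
by have := set_valP z.
Qed.

Lemma merge_rel_sym : symmetric merge_rel.
Proof.
suff H z w : merge_rel z w -> merge_rel w z by move=> z w; apply/idP/idP; exact: H.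
move=> /asboolP[zw p]; apply/asboolP; split => //.
by rewrite -zw; exact: path_joined_sym.
Qed.

Lemma merge_rel_trans : transitive merge_rel.
Proof.
move=> w z u /asboolP[zw p] /asboolP[wu q]; apply/asboolP; split.
  by rewrite zw.
by apply: path_joined_trans p _; rewrite zw.
Qed.

Definition merge_equiv :=
  EquivRel merge_rel merge_rel_refl merge_rel_sym merge_rel_trans.

Definition tree_space : topologicalType :=
  quotient_topology {eq_quot merge_equiv}.

Definition tree_proj (z : epigraph) : tree_space := \pi_({eq_quot merge_equiv}) z.

Definition tree_height (c : tree_space) : R :=
  (val (repr (c : {eq_quot merge_equiv}))).2.

(* The vertices are the classes of the points (p, f p) with p critical. For f
   admissible the local minima give the leaves and the local maxima, which are
   interior points, give the merges, so no vertex subdivides an edge. *)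
Definition tree_vertices : set tree_space :=
  [set tree_proj z | z in
    [set z | critical f (val z).1 /\ (val z).2 = f (val z).1]].

Definition tree_edges : set (set tree_space) :=
  [set connected_component (~` tree_vertices) c | c in ~` tree_vertices].

Definition tree_einf : set tree_space :=
  [set c | forall x, f x < tree_height c].

Definition merge_tree_of : merge_data R :=
  MergeData tree_vertices tree_edges tree_einf tree_height.

Definition left_of (e e' : set merge_tree_of) :=
  forall z w : epigraph, e (tree_proj z) -> e' (tree_proj w) ->
    val (val z).1 < val (val w).1.

Definition tree_label (v : merge_tree_of) (e : set merge_tree_of) : side :=
  if `[< exists e', child_edges v e' /\ left_of e e' >] then Left else Right.

Definition chiral_merge_tree_of : chiral_data R := ChiralData tree_label.

End tree_of_function.

(* Main.v *)
Require Import Defs.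
From mathcomp Require Import all_boot all_order all_algebra.
From mathcomp Require Import generic_quotient.
From mathcomp Require Import all_classical all_reals all_analysis.
From mathcomp Require Import lra.
Import Order.TTheory GRing.Theory Num.Theory.
Import numFieldNormedType.Exports.

(* Let [M(x, y)] be the maximum of [f] on the segment between [x] and [y]; it is
   an ultrametric apart from [M(x, x) = f x], and [(x, t)] and [(y, t)] have the
   same class in [T_f] iff [M(x, y) <= t].  The functions
   [(y, t) |-> max(t, M(x, y))] and the height separate the points of [T_f] and
   determine its topology; each of them is locally constant where it exceeds the
   height, so removing a point of [T_f] cuts off what lies below it.  This gives
   the merge tree: an edge is a branch [(p, s)], [p] critical, with no vertex
   between its ends, and the two edges below a local maximum [r] lie over the
   two sides of [r].

   Conversely the order of [T_f] is determined by heights and connected sets, and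
   the order determines the vertices, so an isomorphism [T_f -> T_g] matches the
   critical points of [f] and [g] with their values.  It also matches their
   order on the line: for critical [p < q] the maximum of [f] on [[p, q]] is
   attained at some critical [r], and the labels at the vertex of [r] tell on
   which side of [r] the points [p] and [q] lie.  Between consecutive critical
   points both functions are strictly monotone, so the matching extends to an
   increasing homeomorphism [phi] with [f = g \o phi]. *)

Set Implicit Arguments.
Unset Strict Implicit.
Unset Printing Implicit Defensive.

Local Open Scope classical_set_scope.
Local Open Scope ring_scope.
Local Open Scope quotient_scope.

(** The tree is a quotient whose open sets are hard to handle, and [base], the way back from a class
    to the interval, is an arbitrary choice that need not be continuous. What makes the coordinates
    usable is compactness of the sublevel sets of the height: a separating family of continuous
    functions then decides convergence. So continuity into the tree is always checked on the height
    and the functions [join x], in formulas free of [base]. An isomorphism is a homeomorphism that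
    keeps heights and labels; nothing says that it respects cells, while labels are only compared on
    child edges. Vertices, edges and child edges must therefore be recovered from the order first,
    and only then can labels be read. The minima at the two ends enter twice: the ends are critical,
    so a noncritical point lies between two critical neighbours, and every local maximum is
    interior, so it has two sides. Distinct critical values make extrema strict and allow only two
    child edges at a merge. *)

Ltac order_lra :=
  repeat match goal with
  | H : is_true (_ && _) |- _ => case/andP: H => ? ?
  | H : _ /\ _ |- _ => case: H => ? ?
  | H : _ \/ _ |- _ => case: H => ?
  | |- is_true (_ && _) => apply/andP; split
  | |- _ /\ _ => split
  end; first [by lra | by left; order_lra | by right; order_lra].

Lemma continuous_pair (X Y Z : topologicalType) (g : X -> Y) (h : X -> Z) :
  continuous g -> continuous h -> continuous (fun t : X => (g t, h t)).
Proof. by move=> cg ch t; exact: (cvg_pair (@cg t) (@ch t)). Qed.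

(** * The unit interval and its segments *)

Section unit_interval.
Variable R : realType.
Implicit Types x y z : unitI R.

Lemma unitI_ge0 x : 0 <= val x.
Proof. by have := set_valP x; rewrite /unitI /= in_itv /= => /andP[]. Qed.

Lemma unitI_le1 x : val x <= 1.
Proof. by have := set_valP x; rewrite /unitI /= in_itv /= => /andP[]. Qed.

Lemma unitI_lt x y : x <> y -> val x <= val y -> val x < val y.
Proof. by move=> xy le; rewrite lt_neqAle le andbT; apply/eqP => /val_inj. Qed.

Lemma continuous_unitI_val : continuous (val : unitI R -> R).
Proof. exact: initial_continuous. Qed.

Lemma continuous_to_unitI (T : topologicalType) (g : T -> unitI R) :
  continuous (fun t => val (g t)) -> continuous g.
Proof. exact: (continuous_comp_initial (w := set_val)). Qed.

Lemma clampIE (r : R) : 0 <= r <= 1 -> val (clampI r) = r.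
Proof. by case/andP=> r0 r1; rewrite /= (min_idPl r1) (max_idPr r0). Qed.

Lemma clampI_val x : clampI (val x) = x.
Proof. by apply: val_inj; rewrite clampIE // unitI_ge0 unitI_le1. Qed.

Lemma compact_unitI : compact [set: unitI R].
Proof.
have -> : [set: unitI R] = @clampI R @` `[0, 1].
  apply/seteqP; split => // x _; exists (val x); last exact: clampI_val.
  by rewrite /= in_itv /= unitI_ge0 unitI_le1.
apply: continuous_compact; last exact: segment_compact.
exact/continuous_subspaceT/continuous_clampI.
Qed.

Lemma nbhs_unitIP x (U : set (unitI R)) :
  nbhs x U <-> exists2 e : R, 0 < e & forall y, `|val x - val y| < e -> U y.
Proof.
split=> [|[e e0 xU]].
  move=> [_ [[V oV <-]] /= Vx VU].
  have : nbhs (val x) V by exact: open_nbhs_nbhs.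
  by move=> /nbhs_ballP[e /= e0 eV]; exists e => // y xy; apply/VU/eV.
have : nbhs (val x) (ball (val x) e) by exact: nbhsx_ballx.
move=> /(@continuous_unitI_val x); rewrite nbhs_simpl /=; apply: filterS => y; exact: xU.
Qed.

Lemma unitI_IVT (f : unitI R -> R) x y v : continuous f ->
  val x <= val y -> (f x <= v <= f y) || (f y <= v <= f x) ->
  exists2 z, val x <= val z <= val y & f z = v.
Proof.
move=> cf xy fv.
have cF : continuous (f \o @clampI R).
  by move=> r; apply: continuous_comp; [exact: continuous_clampI|exact: cf].
have [|c] := @IVT R (f \o @clampI R) _ _ v xy (continuous_subspaceT cF).
  by rewrite /= !clampI_val ge_min le_max; case/orP: fv => /andP[-> ->]; rewrite ?orbT.
rewrite in_itv /= => /andP[xc cy] <-; exists (clampI c) => //.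
rewrite clampIE ?xc ?cy // (le_trans _ xc) ?unitI_ge0 //=.
by rewrite (le_trans cy) ?unitI_le1.
Qed.

Lemma connected_unitI_itv (a b : R) : 0 <= a -> b <= 1 ->
  connected [set x : unitI R | a <= val x <= b].
Proof.
move=> a0 b1; have -> : [set x : unitI R | a <= val x <= b] = @clampI R @` `[a, b].
  apply/seteqP; split=> [x axb|_ [r /= + <-]].
    by exists (val x); [rewrite /= in_itv|exact: clampI_val].
  rewrite in_itv /= => arb; rewrite /mkset /=.
  have -> : Num.max 0 (Num.min r 1) = r by apply: (@clampIE r); order_lra.
  by [].
apply: connected_continuous_connected; first exact: segment_connected.
exact/continuous_subspaceT/continuous_clampI.
Qed.

Definition between x y : set (unitI R) :=
  [set z | Num.min (val x) (val y) <= val z <= Num.max (val x) (val y)].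

Lemma betweenE x y z :
  between x y z <-> (val x <= val z <= val y) \/ (val y <= val z <= val x).
Proof.
by rewrite /between /mkset; case: (leP (val x) (val y)) => h; split=> ?; order_lra.
Qed.

Lemma betweenC x y : between x y = between y x.
Proof. by apply/seteqP; split => z; rewrite !betweenE; tauto. Qed.

Lemma between_l x y : between x y x.
Proof. by apply/betweenE; case: (leP (val x) (val y)) => h; order_lra. Qed.

(** Here [y] may lie outside the segment from [x] to [z]; this generality gives [seg_max] its
    ultrametric inequality. *)
Lemma between_split x y z : between x z `<=` between x y `|` between y z.
Proof.
move=> u; rewrite /setU /mkset !betweenE; case: (leP (val u) (val y)) => h ?.
  by case: (leP (val x) (val u)) => k; order_lra.
by case: (leP (val x) (val u)) => k; order_lra.
Qed.

End unit_interval.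

(** * Maxima of a continuous function on segments *)

Section segment_max.
Variables (R : realType) (f : unitI R -> R).
Hypothesis cf : continuous f.
Implicit Types x y z : unitI R.

Lemma ex_segment_max x y :
  exists z, between x y z /\ forall u, between x y u -> f u <= f z.
Proof.
have cF : continuous (f \o @clampI R).
  by move=> r; apply: continuous_comp; [exact: continuous_clampI|exact: cf].
have ab : Num.min (val x) (val y) <= Num.max (val x) (val y).
  by rewrite le_max ge_min ge_min lexx.
have [c] := EVT_max ab (continuous_subspaceT cF).
rewrite in_itv /= => /andP[ac cb] cmax; exists (clampI c).
have x01 := (unitI_ge0 x, unitI_le1 x); have y01 := (unitI_ge0 y, unitI_le1 y).
have c01 : 0 <= c <= 1.
  apply/andP; split; first by apply: le_trans ac; rewrite le_min !unitI_ge0.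
  by apply: (le_trans cb); rewrite ge_max !unitI_le1.
split=> [|u xyu]; first by rewrite /between /mkset clampIE // ac.
by have /= := cmax (val u); rewrite clampI_val; apply; rewrite in_itv.
Qed.

Definition segment_argmax x y : unitI R := sval (cid (ex_segment_max x y)).

(** As the value at a point of the segment, and not just a supremum, it inherits strict bounds
    ([seg_max_lt]). *)
Definition seg_max x y : R := f (segment_argmax x y).

Lemma segment_argmaxP x y : between x y (segment_argmax x y).
Proof. by have [] := svalP (cid (ex_segment_max x y)). Qed.

Lemma le_seg_max x y z : between x y z -> f z <= seg_max x y.
Proof. by have [_ +] := svalP (cid (ex_segment_max x y)); exact. Qed.

Lemma seg_max_le x y t : seg_max x y <= t <-> forall z, between x y z -> f z <= t.
Proof.
split=> [h z /le_seg_max /le_trans->//|]; apply; exact: segment_argmaxP.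
Qed.

Lemma seg_max_lt x y t : seg_max x y < t <-> forall z, between x y z -> f z < t.
Proof.
split=> [h z /le_seg_max /le_lt_trans->//|]; apply; exact: segment_argmaxP.
Qed.

Lemma seg_max_sym x y : seg_max x y = seg_max y x.
Proof.
by apply/eqP; rewrite eq_le; apply/andP; split; apply/seg_max_le => z;
  rewrite betweenC => /le_seg_max.
Qed.

Lemma seg_max_id x : seg_max x x = f x.
Proof.
rewrite /seg_max; congr f; apply: val_inj; have /betweenE := segment_argmaxP x x; lra.
Qed.

Lemma le_seg_max_l x y : f x <= seg_max x y.
Proof. exact/le_seg_max/between_l. Qed.

Lemma le_seg_max_r x y : f y <= seg_max x y.
Proof. by rewrite seg_max_sym; exact: le_seg_max_l. Qed.

Lemma seg_max_ultra y x z : seg_max x z <= Num.max (seg_max x y) (seg_max y z).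
Proof.
apply/seg_max_le => u /(@between_split _ x y z)[]/le_seg_max h; rewrite le_max h ?orbT //.
Qed.

Lemma seg_max_between x y z : between x y z -> seg_max x z <= seg_max x y.
Proof.
move=> /betweenE xyz; apply/seg_max_le => u /betweenE xzu; apply: le_seg_max.
by apply/betweenE; order_lra.
Qed.

Lemma seg_max_ultra_le y x z t : seg_max x y <= t -> seg_max y z <= t -> seg_max x z <= t.
Proof. by move=> h k; apply: (le_trans (seg_max_ultra y x z)); rewrite ge_max h. Qed.

Lemma seg_max_ultra_lt y x z t : seg_max x y < t -> seg_max y z < t -> seg_max x z < t.
Proof. by move=> h k; apply: (le_lt_trans (seg_max_ultra y x z)); rewrite gt_max h. Qed.

Lemma seg_max_near y (t : R) : f y < t -> \forall y' \near y, seg_max y y' < t.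
Proof.
move=> yt; have : \forall z \near y, f z < t.
  exact: (cvgr_lt _ (@cf y)).
move=> /nbhs_unitIP[e e0 h]; apply/nbhs_unitIP; exists e => // y' yy'.
by apply/seg_max_lt => z /betweenE zb; apply: h; rewrite ltr_norml; rewrite ltr_norml in yy'; order_lra.
Qed.

(** For [y'] near [y] the side [seg_max y y'] is shorter than [seg_max x y], and in an ultrametric
    triangle the two longest sides are equal. *)
Lemma seg_max_locally_constant x y : f y < seg_max x y ->
  \forall y' \near y, seg_max x y' = seg_max x y.
Proof.
move=> /seg_max_near; apply: filterS => y' h; apply/eqP; rewrite eq_le.
rewrite (@seg_max_ultra_le y) ?lexx ?(ltW h) //=.
by rewrite leNgt; apply/negP => k; have := @seg_max_ultra_lt y' x y _ k; rewrite seg_max_sym h ltxx => /(_ isT).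
Qed.

(** If the two values differ, the larger is at most [seg_max y y'], which near [y] exceeds both
    [f y] and [f y'], and so the smaller value, by less than [e]. *)
Lemma continuous_seg_max x : continuous (seg_max x).
Proof.
move=> y; apply/(@cvgrPdist_le _ R^o _ (nbhs y)) => e e0.
have := @seg_max_near y (f y + e / 2); rewrite ltrDl divr_gt0 // => /(_ isT).
have : \forall z \near y, f y - e / 2 < f z.
  by apply: (cvgr_gt _ (@cf y)); rewrite ltrBlDr ltrDl divr_gt0.
apply: filterS2 => y' h1 h2.
have k1 := seg_max_ultra y x y'; have k2 := seg_max_ultra y' x y; rewrite (seg_max_sym y' y) in k2.
have := le_seg_max_r x y; have := le_seg_max_r x y'.
by move: k1 k2; rewrite !le_max ler_norml => /orP[] ? /orP[] ? ? ?; apply/andP; split; lra.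
Qed.

(** By the intermediate value theorem a path from [x] to [y] covers the segment between them;
    conversely the affine path stays in that segment. *)
Lemma path_joined_sublevel t x y :
  path_joined R (sublevel f t) x y <-> seg_max x y <= t.
Proof.
split=> [[g [cg g0 g1 gt]]|xyt].
  apply/seg_max_le => z /betweenE zb.
  have cvg : continuous (val \o g).
    by move=> s; apply: continuous_comp; [exact: cg|exact: continuous_unitI_val].
  have [||s _ /= gs] := @unitI_IVT _ (val \o g) I0 I1 (val z) cvg.
  - by rewrite /= ler01.
  - by rewrite /= g0 g1; apply/orP; case: zb; [left|right].
  by rewrite -(val_inj gs); exact: gt.
exists (fun s : unitI R => clampI ((1 - val s) * val x + val s * val y)).
have vE (s : unitI R) : val (clampI ((1 - val s) * val x + val s * val y)) =
   (1 - val s) * val x + val s * val y.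
  have [x0 x1 y0 y1] := And4 (unitI_ge0 x) (unitI_le1 x) (unitI_ge0 y) (unitI_le1 y).
  by have [s0 s1] := (unitI_ge0 s, unitI_le1 s); apply: clampIE; apply/andP; split; nra.
split.
- apply: continuous_to_unitI; rewrite (funext vE) => s.
  apply: (@continuous_comp (unitI R) R R val
    (fun r => (1 - r) * val x + r * val y)); first exact: continuous_unitI_val.
  by apply: cvgD; apply: cvgM; (try apply: cvgB); (try exact: cvg_cst); exact: cvg_id.
- by apply: val_inj; rewrite vE /=; lra.
- by apply: val_inj; rewrite vE /=; lra.
- move=> s; rewrite /sublevel /=; move/seg_max_le: xyt; apply; apply/betweenE; rewrite vE.
  by have [s0 s1] := (unitI_ge0 s, unitI_le1 s); case: (leP (val x) (val y)) => h; nra.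
Qed.

End segment_max.

(** * Transport along homeomorphisms *)

Section homeomorphism_transport.
Variables (T U : topologicalType) (h : T -> U) (k : U -> T).
Hypotheses (ch : continuous h) (ck : continuous k).
Hypotheses (hk : cancel h k) (kh : cancel k h).

Lemma image_homeo (A : set T) : h @` A = k @^-1` A.
Proof.
apply/seteqP; split=> [_ [x Ax <-]|u ku]; first by rewrite /preimage /mkset hk.
by exists (k u).
Qed.

Lemma closure_homeo (A : set T) : closure (h @` A) = h @` closure A.
Proof.
rewrite [RHS]image_homeo; apply/seteqP; split=> u cu B.
  move=> Bu; have [_ [[y Ay <-] By]] := cu (k @^-1` B) (ck Bu).
  by exists y; split=> //; rewrite -(hk y).
move=> Bu; have : nbhs (k u) (h @^-1` B) by apply: ch; rewrite kh.
by move=> /cu[y [Ay By]]; exists (h y); split=> //; exists y.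
Qed.

Lemma connected_component_homeo (A : set T) (B : set U) x :
  (forall y, A y <-> B (h y)) ->
  h @` connected_component A x = connected_component B (h x).
Proof.
move=> AB; apply/seteqP; split.
  move=> _ [y [C [Cx CA cC] Cy] <-]; exists (h @` C); last by exists y.
  split; first by exists x.
    by move=> _ [z Cz <-]; apply/AB; exact: CA.
  by apply: connected_continuous_connected => //; exact: continuous_subspaceT.
move=> u [C [Cx CB cC] Cu]; exists (k u) => //; exists (k @` C); last by exists u.
split; first by exists (h x).
  by move=> _ [z Cz <-]; apply/AB; rewrite kh; exact: CB.
by apply: connected_continuous_connected => //; exact: continuous_subspaceT.
Qed.

End homeomorphism_transport.

(* On the merge tree of a function this is the order in which a point precedes
   the points of the upward branch it starts. *)
Definition below (R : realType) (T : merge_data R) (c d : T) :=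
  exists C : set T,
    [/\ connected C, C c, C d & forall e, C e -> height e <= height d].

Section merge_data_transport.
Variables (R : realType) (T U : merge_data R) (h : T -> U) (k : U -> T).
Hypotheses (ch : continuous h) (ck : continuous k).
Hypotheses (hk : cancel h k) (kh : cancel k h).
Hypothesis hh : forall c, height (h c) = height c.

Lemma below_homeo c d : below c d -> below (h c) (h d).
Proof.
move=> [C [cC Cc Cd Cle]]; exists (h @` C); split.
- by apply: connected_continuous_connected => //; exact: continuous_subspaceT.
- by exists c.
- by exists d.
- by move=> _ [e Ce <-]; rewrite !hh; exact: Cle.
Qed.

Hypothesis hV : forall c, vertices T c -> vertices U (h c).
Hypothesis hE : forall e, edges T e -> edges U (h @` e).

Lemma ends_homeo (e : set T) : ends (h @` e) = h @` ends e.
Proof.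
rewrite /ends (closure_homeo ch ck hk kh); apply/seteqP; split.
  move=> _ [[c cc <-] nc]; exists c => //; split=> // ec; apply: nc; by exists c.
move=> _ [c [cc nc] <-]; split; first by exists c.
by move=> [d ed /(can_inj hk) dc]; apply: nc; rewrite -dc.
Qed.

Lemma child_edges_homeo v e : child_edges v e -> child_edges (h v) (h @` e).
Proof.
move=> [Ee [w [Vw wv [e' Ee' eE']] eE]]; split; first exact: hE.
have img a b : h @` [set a; b] = [set h a; h b] by rewrite image_setU !image_set1.
exists (h w); last by rewrite ends_homeo eE img.
split; [exact: hV|by rewrite !hh|].
by exists (h @` e'); [exact: hE|rewrite ends_homeo eE' img].
Qed.

End merge_data_transport.

(** * The topology of the tree of a continuous function *)

(** [g] sends a cluster point of [F] to a cluster point of [g @ F], and in a Hausdorff space that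
    can only be the limit. *)
Lemma cluster_cvg_eq (R : realType) (X : topologicalType) (F : set_system X)
    {FF : Filter F} (g : X -> R) (l : R) (q : X) :
  g @ F --> l -> continuous g -> cluster F q -> g q = l.
Proof.
move=> gl cg Fq; apply/esym; apply: (@Rhausdorff R) => A B Al Bq.
have [z [Az Bz]] := Fq _ _ (gl _ Al) (@cg q _ Bq).
by exists (g z).
Qed.

Section tree_topology.
Variables (R : realType) (f : unitI R -> R).
Hypothesis cf : continuous f.
Implicit Types (x y : unitI R) (c d : tree_space f).

Local Notation T := (tree_space f).
Local Notation seg_max := (seg_max cf).
Local Notation ht := (@tree_height R f).

Fact epi_point_subproof x (t : R) : (x, Num.max t (f x)) \in epigraph f.
Proof. by apply/mem_set; rewrite /epigraph /mkset /= le_max lexx orbT. Qed.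

(** Raising [t] to [f x] makes this a total function of [x] and [t], with no proof argument, so that
    continuity and compactness can be argued on a product. *)
Definition epi_point x (t : R) : epigraph f := exist _ (x, Num.max t (f x)) (epi_point_subproof x t).

Definition tpoint x (t : R) : T := tree_proj (epi_point x t).

Definition base c : unitI R := (val (repr (c : {eq_quot merge_equiv f}))).1.

Lemma epi_pointE (z : epigraph f) : z = epi_point (val z).1 (val z).2.
Proof.
apply: val_inj; case: z => -[x t] /= zE; congr pair.
by apply/esym/max_idPl; move/set_mem: zE.
Qed.

Lemma eq_tree_proj (z w : epigraph f) : tree_proj z = tree_proj w <->
  (val z).2 = (val w).2 /\ seg_max (val z).1 (val w).1 <= (val z).2.
Proof.
split=> [/(@eqmodP _ (merge_equiv f))/asboolP[zw /(path_joined_sublevel cf)]//|].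
move=> [zw mzw]; apply/(@eqmodP _ (merge_equiv f))/asboolP; split=> //.
exact/path_joined_sublevel.
Qed.

Lemma height_proj (z : epigraph f) : ht (tree_proj z) = (val z).2.
Proof.
rewrite /tree_height /tree_proj.
by have /eq_tree_proj[] : tree_proj (repr (tree_proj z : {eq_quot merge_equiv f})) = tree_proj z
  by rewrite /tree_proj reprK.
Qed.

Lemma height_tpoint x t : f x <= t -> ht (tpoint x t) = t.
Proof. by move=> xt; rewrite height_proj /= (max_idPl xt). Qed.

Lemma tpoint_base c : tpoint (base c) (ht c) = c.
Proof. by rewrite /tpoint -epi_pointE /tree_proj reprK. Qed.

Lemma le_base c : f (base c) <= ht c.
Proof. by have := set_valP (repr (c : {eq_quot merge_equiv f})). Qed.

Lemma eq_tpoint x y t : f x <= t -> f y <= t -> tpoint x t = tpoint y t <-> seg_max x y <= t.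
Proof.
move=> xt yt; rewrite eq_tree_proj /= (max_idPl xt) (max_idPl yt).
by split=> [[]|].
Qed.

Lemma tpoint_inj x y s t : f x <= s -> f y <= t -> tpoint x s = tpoint y t ->
  s = t /\ seg_max x y <= t.
Proof.
move=> xs yt st; have sE : s = t by rewrite -(height_tpoint xs) st height_tpoint.
by rewrite sE in xs st; split=> //; apply/eq_tpoint.
Qed.

Lemma tpointP c : exists x t, f x <= t /\ c = tpoint x t.
Proof. by exists (base c), (ht c); rewrite tpoint_base; split=> //; exact: le_base. Qed.

Lemma projE (z : epigraph f) : tree_proj z = tpoint (val z).1 (val z).2.
Proof. by rewrite /tpoint -epi_pointE. Qed.

Lemma base_tpoint x t : f x <= t -> seg_max x (base (tpoint x t)) <= t.
Proof.
move=> xt; apply/eq_tpoint => //.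
  by have := le_base (tpoint x t); rewrite height_tpoint.
by have := tpoint_base (tpoint x t); rewrite height_tpoint.
Qed.

(* The height at which the branch upward from [c] meets the one of [x]. *)
Definition join x c : R := Num.max (ht c) (seg_max x (base c)).

(** The choice behind [base] is harmless: two representatives are joined at height [t], and the
    maximum with [t] hides their difference. *)
Lemma join_tpoint x y t : f y <= t -> join x (tpoint y t) = Num.max t (seg_max x y).
Proof.
move=> yt; rewrite /join height_tpoint //; have b := base_tpoint yt.
have H u v : seg_max u v <= t -> seg_max x v <= Num.max t (seg_max x u).
  by move=> uv; apply: (seg_max_ultra_le (y := u)); rewrite le_max ?lexx ?uv ?orbT.
by apply/eqP; rewrite eq_le !ge_max H ?H ?(seg_max_sym _ _ y) // !le_max lexx.
Qed.

Lemma join_proj x (z : epigraph f) :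
  join x (tree_proj z) = Num.max (val z).2 (seg_max x (val z).1).
Proof. by rewrite projE join_tpoint //; have := set_valP z. Qed.

Lemma le_join x c : ht c <= join x c.
Proof. by rewrite le_max lexx. Qed.

Lemma join_gt x c : ht c < join x c -> join x c = seg_max x (base c).
Proof. by rewrite /join lt_max ltxx => /ltW/max_idPr. Qed.

Lemma le_join_base x c : f x <= join x c.
Proof. by rewrite le_max le_seg_max_l orbT. Qed.

Lemma join_base c : join (base c) c = ht c.
Proof. by apply/max_idPl; rewrite seg_max_id; exact: le_base. Qed.

(** The equation [join x c = ht c] expresses that [c] lies on the upward branch of [x]. *)
Lemma join_heightP x c : join x c = ht c -> c = tpoint x (ht c).
Proof.
move=> j; rewrite -[LHS]tpoint_base; apply/eq_tpoint; first exact: le_base.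
  by rewrite -j le_join_base.
by rewrite seg_max_sym -[leRHS]j le_max lexx orbT.
Qed.

Lemma continuous_tree_proj : continuous (@tree_proj R f).
Proof. exact: pi_continuous. Qed.

Lemma continuous_height : continuous ht.
Proof.
apply/quotient_continuous.
rewrite (_ : _ \o _ = fun z : epigraph f => (val z).2).
  move=> z; apply: (@continuous_comp _ _ _ (val : epigraph f -> _) snd).
    exact: initial_continuous.
  exact: cvg_snd.
by apply/funext => z; exact: height_proj.
Qed.

Lemma continuous_join x : continuous (join x).
Proof.
apply/quotient_continuous.
rewrite (_ : _ \o _ = fun z : epigraph f => Num.max (val z).2 (seg_max x (val z).1)).
  apply: (@max_fun_continuous _ (epigraph f) R (fun z => (val z).2)
    (fun z => seg_max x (val z).1)) => z.
    apply: (@continuous_comp _ _ _ (val : epigraph f -> _) snd).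
      exact: initial_continuous.
    exact: cvg_snd.
  apply: (@continuous_comp _ _ _ (fun z : epigraph f => (val z).1) (seg_max x)).
    apply: (@continuous_comp _ _ _ (val : epigraph f -> _) fst).
      exact: initial_continuous.
    exact: cvg_fst.
  exact: continuous_seg_max.
by apply/funext => z; exact: join_proj.
Qed.

Lemma continuous_tpoint : continuous (fun p : unitI R * R => tpoint p.1 p.2).
Proof.
move=> p; apply: (@continuous_comp _ _ _ (fun p : unitI R * R => epi_point p.1 p.2));
  last exact: continuous_tree_proj.
apply: (continuous_comp_initial (w := set_val)) => {}p.
apply: (@continuous_pair (unitI R * R)%type (unitI R) R fst
  (fun q => Num.max q.2 (f q.1))); first by move=> q; exact: cvg_fst.
apply: (@max_fun_continuous _ (unitI R * R)%type R snd (f \o fst)) => q.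
  exact: cvg_snd.
by apply: (@continuous_comp _ _ _ fst f); [exact: cvg_fst|exact: cf].
Qed.

Lemma continuous_tpoint_height x : continuous (tpoint x).
Proof.
move=> t; apply: (@continuous_comp _ _ _ (fun t : R => (x, t))
  (fun p : unitI R * R => tpoint p.1 p.2)); last exact: continuous_tpoint.
apply: (@continuous_pair R (unitI R) R) => {}t; [exact: cvg_cst|exact: cvg_id].
Qed.

Lemma open_join_eq x (a : R) : open [set c | join x c = a /\ ht c < a].
Proof.
rewrite /open /= /quotient_open openE => z /= [za zh].
have {}za : join x (tree_proj z) = a by [].
have {}zh : ht (tree_proj z) < a by [].
rewrite join_proj in za; rewrite height_proj in zh.
have mza : seg_max x (val z).1 = a.
  by move: za zh; case: (leP (val z).2 (seg_max x (val z).1)) => // ? ->; rewrite ltxx.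
have n1 : \forall y \near (val z).1, seg_max x y = a.
  have := @seg_max_locally_constant _ _ cf x (val z).1; rewrite mza; apply.
  by apply: le_lt_trans zh; have := set_valP z.
have c1 : (fun z : epigraph f => (val z).1) @ z --> (val z).1.
  apply: (@continuous_comp _ _ _ (val : epigraph f -> _) fst).
    exact: initial_continuous.
  exact: cvg_fst.
have c2 : (fun z : epigraph f => (val z).2) @ z --> (val z).2.
  apply: (@continuous_comp _ _ _ (val : epigraph f -> _) snd).
    exact: initial_continuous.
  exact: cvg_snd.
have n2 : \forall w \near z, (val w).2 < a by exact: (cvgr_lt _ c2).
have {}n1 : \forall w \near z, seg_max x (val w).1 = a by exact: c1 n1.
apply: filterS2 n1 n2 => w w1 w2 /=; split.
  by rewrite -[LHS]/(join x (tree_proj w)) join_proj w1; apply/max_idPr/ltW.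
by rewrite -[ltLHS]/(ht (tree_proj w)) height_proj.
Qed.

(** The test point [base d] suffices: since [join (base d) d] is the height of [d], [c] lies on the
    branch of [base d], at the height of [d]. *)
Lemma eq_join c d : ht c = ht d -> (forall x, join x c = join x d) -> c = d.
Proof.
move=> h j; rewrite (@join_heightP (base d) c) ?j ?join_base ?h //.
by rewrite tpoint_base.
Qed.

Lemma tree_hausdorff : hausdorff_space T.
Proof.
move=> c d cd; apply/esym/eq_join => [|x].
  exact: (cluster_cvg_eq (@continuous_height c) continuous_height cd).
exact: (cluster_cvg_eq (@continuous_join x c) (@continuous_join x) cd).
Qed.

Lemma compact_height_le (a : R) : compact [set c | ht c <= a].
Proof.
have [m seg_max_ge] : exists m, forall x, m <= f x.
  have [c _ cP] := compact_EVT_min (ex_intro _ I0 I : [set: unitI R] !=set0)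
    (@compact_unitI R) (continuous_subspaceT cf).
  by exists (f c) => x; apply: cP; exact: mem_set.
(* Only an inclusion in the image of the rectangle is available: [tpoint] lifts points below the
   graph, possibly above height [a]. *)
apply: (@subclosed_compact _ _
    ((fun p : unitI R * R => tpoint p.1 p.2) @` (setT `*` `[m, a]))).
- rewrite (_ : mkset _ = ht @^-1` [set t | t <= a]) //.
  by apply: closed_comp => [c _|]; [exact: continuous_height|exact: closed_le].
- apply: continuous_compact; first exact/continuous_subspaceT/continuous_tpoint.
  by apply: compact_setX; [exact: compact_unitI|exact: segment_compact].
- move=> c /= ca; exists (base c, ht c) => /=; last exact: tpoint_base.
  by split=> //=; rewrite in_itv /= ca (le_trans (seg_max_ge (base c)) (le_base c)).
Qed.

(** The limits of the height and the joins leave [c] as the only possible cluster point, and [F]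
    eventually lies in the compact set of points of height at most [ht c + 1]. *)
Lemma tree_cvg (F : set_system T) c : ProperFilter F ->
  ht @ F --> ht c -> (forall x, join x @ F --> join x c) -> F --> c.
Proof.
move=> FF Fh Fj.
have clF d : cluster F d -> d = c.
  move=> Fd; apply: eq_join => [|x].
    exact: (cluster_cvg_eq Fh continuous_height Fd).
  exact: (cluster_cvg_eq (Fj x) (@continuous_join x) Fd).
have hc1 : ht c < ht c + 1 by rewrite ltrDl.
have FV : F [set d | ht d <= ht c + 1].
  by apply: (@filterS _ F _ _ _ _ (cvgr_lt _ Fh _ hc1)) => d /ltW.
apply: (compact_cluster_set1 tree_hausdorff (@compact_height_le (ht c + 1))) => //.
  by apply: (@filterS _ (nbhs c) _ _ _ _
    (cvgr_lt _ (@continuous_height c) _ hc1)) => d /ltW.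
have [d [_ Fd]] := @compact_height_le (ht c + 1) F FF FV.
apply/seteqP; split=> [e /clF -> //|_ ->].
by rewrite -(clF _ Fd).
Qed.

Lemma continuous_to_tree (X : topologicalType) (g : X -> T) :
  continuous (ht \o g) -> (forall x, continuous (join x \o g)) -> continuous g.
Proof. by move=> h j p; apply: tree_cvg; [exact: h|move=> x; exact: j]. Qed.

(* Otherwise [join x < a] would define a clopen part of [C], because [join x] is
   locally constant where it exceeds the height. *)
Lemma connected_join (C : set T) x (a : R) c d : connected C -> C c -> C d ->
  join x c < a -> a <= join x d -> C (tpoint x a).
Proof.
move=> Cc Ccc Cd xca axd; apply: contrapT => nC.
have BC : C `&` [set e | join x e < a] = C.
  apply: Cc; first by exists c.
    exists [set e | join x e < a] => //.
    rewrite (_ : mkset _ = join x @^-1` [set t | t < a]) //.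
    by apply: open_comp => [e _|]; [exact: continuous_join|exact: open_lt].
  (* Besides [join x e < a] this closed set allows only [join x e = a = ht e], that is
     [e = tpoint x a], which is not in [C]. *)
  exists (~` ([set e | a < join x e] `|` [set e | join x e = a /\ ht e < a])).
    apply: open_closedC; apply: openU; last exact: open_join_eq.
    rewrite (_ : mkset _ = join x @^-1` [set t | a < t]) //.
    by apply: open_comp => [e _|]; [exact: continuous_join|exact: open_gt].
  apply/seteqP; split=> e [Ce ea]; split=> //=.
    by move=> [/= h|[/= h _]]; move: ea; rewrite /= ?h ?ltxx // ltNge (ltW h).
  move: ea => /not_orP [/= /negP]; rewrite -leNgt le_eqVlt => /orP[/eqP je|//] ne.
  exfalso; apply: nC; rewrite (_ : tpoint x a = e) //.
  suff he : ht e = a by rewrite -he -join_heightP // je he.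
  apply/eqP; rewrite eq_le -{1}je le_join /= leNgt; apply/negP => h.
  by apply: ne.
have : (C `&` [set e | join x e < a]) d by rewrite BC.
by move=> [_ /=]; rewrite ltNge axd.
Qed.

(** * Connectedness and contractibility of the tree *)

Definition fmax : R := seg_max I0 I1.

Lemma le_top x : f x <= fmax.
Proof. by apply: le_seg_max; apply/betweenE; left; rewrite unitI_ge0 unitI_le1. Qed.

Lemma seg_max_le_top x y : seg_max x y <= fmax.
Proof. exact: le_top. Qed.

Lemma tpoint_top x y (t : R) : fmax <= t -> tpoint x t = tpoint y t.
Proof.
move=> tt; apply/eq_tpoint; first exact: le_trans (le_top _) tt.
  exact: le_trans (le_top _) tt.
exact: le_trans (seg_max_le_top _ _) tt.
Qed.

Lemma connected_tpoint x (A : set R) : is_interval A -> connected (tpoint x @` A).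
Proof.
move=> /connected_intervalP cA; apply: connected_continuous_connected => //.
exact/continuous_subspaceT/continuous_tpoint_height.
Qed.

(** [S] is a union of vertical segments ending at the one point of height [fmax]. Points above that
    height reach it downwards, whence the two cases. *)
Lemma connected_tree (S : set T) :
  (forall c, S c -> forall s, ht c <= s <= fmax \/ fmax <= s <= ht c ->
     S (tpoint (base c) s)) -> connected S.
Proof.
move=> HS.
pose A c := tpoint (base c) @` [set s | ht c <= s <= fmax \/ fmax <= s <= ht c].
have -> : S = \bigcup_(c in S) A c.
  apply/seteqP; split=> c => [Sc|[d Sd [s sP <-]]]; last exact: HS sP.
  exists c => //; exists (ht c); last exact: tpoint_base.
  by rewrite /mkset lexx; case: (leP (ht c) fmax) => h; [left|right; rewrite ltW].
apply: bigcup_connected => [|c Sc].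
  exists (tpoint I0 fmax) => c Sc; exists fmax; last exact: tpoint_top.
  by rewrite /mkset lexx; case: (leP (ht c) fmax) => h; [left|right; rewrite ltW].
apply: connected_tpoint => a b /= ha hb s sab.
by case: (leP (ht c) fmax) => h; [left|right]; order_lra.
Qed.

Definition toward_top (s : unitI R) (h : R) : R := (1 - val s) * h + val s * fmax.

Lemma toward_top_bounds s h :
  h <= toward_top s h <= fmax \/ fmax <= toward_top s h <= h.
Proof.
have [s0 s1] := (unitI_ge0 s, unitI_le1 s); rewrite /toward_top.
by case: (leP h fmax) => ht; [left|right]; apply/andP; split; nra.
Qed.

Lemma le_toward_top (s : unitI R) c : f (base c) <= toward_top s (ht c).
Proof.
have := toward_top_bounds s (ht c); have := le_base c; have := le_top (base c).
by move=> ? ? ?; order_lra.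
Qed.

(** Points below the top move up and points of [tree_einf] move down, so the same map also contracts
    the complement of [tree_einf]. *)
Definition contraction (p : unitI R * T) : T :=
  tpoint (base p.2) (toward_top p.1 (ht p.2)).

Lemma height_contraction p : ht (contraction p) = toward_top p.1 (ht p.2).
Proof. exact/height_tpoint/le_toward_top. Qed.

(** This eliminates [base]. If the maximum [m] over the segment is at least the height, both sides
    contain [m]; otherwise both equal the new height, which is at least [m] and at least the smaller
    of [fmax] and the old height. *)
Lemma join_contraction x p :
  join x (contraction p) =
  Num.max (toward_top p.1 (ht p.2)) (Num.min fmax (join x p.2)).
Proof.
rewrite join_tpoint; last exact: le_toward_top.
rewrite /join; have := toward_top_bounds p.1 (ht p.2).
have := seg_max_le_top x (base p.2).
set t := toward_top _ _; set m := seg_max x _; set h := ht p.2 => mM tb.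
case: (leP h m) => hm; first by rewrite (min_idPr mM).
apply/eqP; rewrite eq_le !ge_max !le_max !le_min !ge_min !lexx ?orbT /=.
have : (m <= t) && ((fmax <= t) || (h <= t)).
  by apply/andP; split; [|apply/orP]; order_lra.
by case/andP=> -> ->.
Qed.

Lemma continuous_toward_top : continuous (fun p : unitI R * T =>
  toward_top p.1 (ht p.2)).
Proof.
have c1 : continuous (fun p : unitI R * T => val p.1 : R).
  move=> p; apply: (@continuous_comp _ _ _ fst (val : unitI R -> R)).
    exact: cvg_fst.
  exact: continuous_unitI_val.
have c2 : continuous (fun p : unitI R * T => ht p.2).
  move=> p; apply: (@continuous_comp _ _ _ snd ht); first exact: cvg_snd.
  exact: continuous_height.
move=> p; apply: cvgD; apply: cvgM.
- by apply: cvgB; [exact: cvg_cst|exact: c1].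
- exact: c2.
- exact: c1.
- exact: cvg_cst.
Qed.

Lemma continuous_contraction : continuous contraction.
Proof.
apply: continuous_to_tree => [|x].
  rewrite (_ : _ \o _ = fun p : unitI R * T => toward_top p.1 (ht p.2)).
    exact: continuous_toward_top.
  by apply/funext => p; exact: height_contraction.
rewrite (_ : _ \o _ = fun p : unitI R * T =>
    Num.max (toward_top p.1 (ht p.2)) (Num.min fmax (join x p.2))); last first.
  by apply/funext => p; exact: join_contraction.
apply: (@max_fun_continuous _ (unitI R * T)%type R
  (fun p => toward_top p.1 (ht p.2)) (fun p => Num.min fmax (join x p.2))).
  exact: continuous_toward_top.
apply: (@min_fun_continuous _ (unitI R * T)%type R (fun=> fmax)
  (fun p => join x p.2)); first exact: cst_continuous.
move=> p; apply: (@continuous_comp _ _ _ snd (join x)); first exact: cvg_snd.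
exact: continuous_join.
Qed.

Lemma contraction0 c : contraction (I0, c) = c.
Proof. by rewrite /contraction /toward_top /= subr0 mul1r mul0r addr0 tpoint_base. Qed.

Lemma contraction1 c : contraction (I1, c) = tpoint I0 fmax.
Proof.
by rewrite /contraction /toward_top /= subrr mul0r add0r mul1r; exact: tpoint_top.
Qed.

Lemma contractible_tree : contractible R T.
Proof.
exists contraction, (tpoint I0 fmax); split; first exact: continuous_contraction.
  exact: contraction0.
exact: contraction1.
Qed.

Lemma contractible_subtree (S : set T) : S (tpoint I0 fmax) ->
  (forall s c, S c -> S (contraction (s, c))) -> contractible R (set_type S).
Proof.
move=> St HS.
have HS' (p : unitI R * S) : contraction (p.1, val p.2) \in S.
  by apply/mem_set/HS; exact: set_valP.
exists (fun p => exist _ (contraction (p.1, val p.2)) (HS' p)).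
exists (exist _ (tpoint I0 fmax) (mem_set St)); split.
- apply: (continuous_comp_initial (w := set_val)) => p.
  apply: (@continuous_comp _ _ _ (fun p : unitI R * S => (p.1, val p.2 : T))
    contraction); last exact: continuous_contraction.
  apply: (@continuous_pair (unitI R * S)%type (unitI R) T fst
    (fun p => val p.2)) => {}p; first exact: cvg_fst.
  apply: (@continuous_comp _ _ _ snd (val : S -> T)); first exact: cvg_snd.
  exact: initial_continuous.
- by move=> c; apply: val_inj; exact: contraction0.
- by move=> c; apply: val_inj; exact: contraction1.
Qed.

End tree_topology.

(** * Critical points *)

Lemma finite_arg_max (R : realType) (X : Type) (A : set X) (g : X -> R) :
  finite_set A -> A !=set0 -> exists2 a, A a & forall b, A b -> g b <= g a.
Proof.
move=> finA [a0 Aa0].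
have : finite_set (g @` A) by exact: finite_image.
move=> /finite_seqP[s sE].
have gs a : A a -> g a \in s by move=> Aa; have : (g @` A) (g a) by [exists a]; rewrite sE.
have [m ms mP] : exists2 m, m \in s & forall r, r \in s -> r <= m.
  have : s != [::] by case: (s) (gs _ Aa0).
  elim: (s) => // r [|r' s'] IH _; first by exists r => [|?]; rewrite inE // => /eqP->.
  have [m ms mP] := IH isT; case: (leP r m) => rm.
    by exists m => [|u]; rewrite in_cons ?ms ?orbT // => /orP[/eqP->|/mP].
  exists r => [|u]; rewrite in_cons ?eqxx // => /orP[/eqP->//|/mP um].
  exact: le_trans um (ltW rm).
have : (g @` A) m by rewrite sE.
by move=> [a Aa am]; exists a => // b /gs /mP; rewrite am.
Qed.

Lemma finite_arg_min (R : realType) (X : Type) (A : set X) (g : X -> R) :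
  finite_set A -> A !=set0 -> exists2 a, A a & forall b, A b -> g a <= g b.
Proof.
move=> finA A0; have [a Aa aP] := @finite_arg_max R X A (fun x => - g x) finA A0.
by exists a => // b /aP; rewrite lerN2.
Qed.

Section continuous_critical.
Variables (R : realType) (f : unitI R -> R).
Hypothesis cf : continuous f.
Implicit Types x y z : unitI R.

Lemma nbhs_open_interval x y z : val x < val z < val y ->
  \forall u \near z, val x < val u < val y.
Proof.
move=> /andP[xz zy]; apply/nbhs_unitIP.
exists (Num.min (val z - val x) (val y - val z)).
  by rewrite lt_min !subr_gt0 xz.
by move=> u; rewrite lt_min !ltr_norml => h; order_lra.
Qed.

Lemma interior_max x y z : val x < val z < val y -> seg_max cf x y <= f z -> critical f z.
Proof.
move=> xzy m; right; apply: filterS (nbhs_open_interval xzy) => u xuy.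
by apply: le_trans m; apply: le_seg_max; apply/betweenE; left; order_lra.
Qed.

(** A maximum inside the segment is a local maximum; this is how critical points between two given
    points are produced. *)
Lemma segment_max_cases x y : seg_max cf x y = f x \/ seg_max cf x y = f y \/
  exists z, [/\ between x y z, z <> x, z <> y, critical f z & f z = seg_max cf x y].
Proof.
have [z [zb zE]] : exists z, between x y z /\ f z = seg_max cf x y.
  by exists (segment_argmax cf x y); split=> //; exact: segment_argmaxP.
have [zx|zx] := pselect (z = x); first by left; rewrite -zE zx.
have [zy|zy] := pselect (z = y); first by right; left; rewrite -zE zy.
right; right; exists z; split=> //.
case/betweenE: (zb) => /andP[h k].
  by apply: (@interior_max x y); rewrite ?zE // (unitI_lt (nesym zx) h) (unitI_lt zy k).
apply: (@interior_max y x); last by rewrite seg_max_sym zE.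
by rewrite (unitI_lt (nesym zy) h) (unitI_lt zx k).
Qed.

Lemma gap_max x y z : (forall u : unitI R, val x < val u < val y -> ~ critical f u) ->
  val x <= val z <= val y -> f z <= f x \/ f z <= f y.
Proof.
move=> gap xzy; have : f z <= seg_max cf x y by apply: le_seg_max; apply/betweenE; left.
case: (segment_max_cases x y) => [->|[->|[u [ub ux uy cu _]]]]; [by left|by right|].
exfalso; apply: (gap u) => //; case/betweenE: ub => /andP[h k].
  by rewrite (unitI_lt (nesym ux) h) (unitI_lt uy k).
by case: ux; apply: val_inj; apply/eqP; rewrite eq_le; order_lra.
Qed.

End continuous_critical.

Lemma criticalN (R : realType) (f : unitI R -> R) : critical (fun x => - f x) = critical f.
Proof.
apply/seteqP; split=> x [] h; [right|left|right|left];
  by apply: filterS h => y; rewrite lerN2.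
Qed.

Lemma continuousN_fun (R : realType) (f : unitI R -> R) :
  continuous f -> continuous (fun x => - f x).
Proof. by move=> cf x; apply: (@continuousN R R^o (unitI R) f x); exact: cf. Qed.

Lemma gap_min (R : realType) (f : unitI R -> R) (x y z : unitI R) : continuous f ->
  (forall u : unitI R, val x < val u < val y -> ~ critical f u) ->
  val x <= val z <= val y -> f x <= f z \/ f y <= f z.
Proof.
rewrite -criticalN => /continuousN_fun cf gap /(gap_max cf gap).
by rewrite !lerN2.
Qed.

(** If [f x = f y], then [f] is constant between them and the midpoint is critical. If [f y < f x],
    then [gap_max] on [[a, y]] gives [f x <= f a], so [f y] is below both [f a] and [f b], against
    [gap_min]. *)
Lemma gap_increasing (R : realType) (f : unitI R -> R) (a b x y : unitI R) :
  continuous f -> (forall p q, critical f p -> critical f q -> f p = f q -> p = q) ->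
  (forall u : unitI R, val a < val u < val b -> ~ critical f u) ->
  f a <= f b -> val a <= val x -> val x < val y -> val y <= val b -> f x < f y.
Proof.
move=> cf inj gap fab ax xy yb; rewrite ltNge le_eqVlt; apply/negP => /orP[/eqP yx|yx].
  have xyE (z : unitI R) : val x <= val z <= val y -> f z = f x.
    have gap' (u : unitI R) : val x < val u < val y -> ~ critical f u.
      by move=> ?; apply: gap; order_lra.
    move=> xzy; apply/eqP; rewrite eq_le.
    have := gap_max cf gap' xzy; have := gap_min cf gap' xzy.
    by rewrite yx => -[] -> [] ->.
  pose m := clampI ((val x + val y) / 2).
  have mE : val m = (val x + val y) / 2.
    by apply: clampIE; have := unitI_ge0 x; have := unitI_le1 y; order_lra.
  apply: (gap m); first by rewrite mE; order_lra.
  right; apply: filterS (@nbhs_open_interval _ x y m _) => [u h|].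
    by rewrite !xyE ?mE //; order_lra.
  by rewrite mE; order_lra.
have h1 : f x <= f a \/ f x <= f y.
  by apply: (gap_max cf) => [u ?|]; [apply: gap|]; order_lra.
have h2 : f a <= f y \/ f b <= f y.
  by apply: (gap_min cf) => [u ?|]; [apply: gap|]; order_lra.
by case: h1 => ?; case: h2 => ?; lra.
Qed.

Lemma gap_decreasing (R : realType) (f : unitI R -> R) (a b x y : unitI R) :
  continuous f -> (forall p q, critical f p -> critical f q -> f p = f q -> p = q) ->
  (forall u : unitI R, val a < val u < val b -> ~ critical f u) ->
  f b <= f a -> val a <= val x -> val x < val y -> val y <= val b -> f y < f x.
Proof.
rewrite -criticalN => /continuousN_fun cf inj gap fab ax xy yb.
have := @gap_increasing R (fun x => - f x) a b x y cf; rewrite ltrN2 lerN2; apply=> //.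
by move=> p q cp cq /oppr_inj; exact: inj.
Qed.

(** * The chiral merge tree *)

Section nice_function.
Variables (R : realType) (f : unitI R -> R).
Hypothesis cf : continuous f.
Hypothesis fin : finite_set (critical f).
Hypothesis inj : forall p q, critical f p -> critical f q -> f p = f q -> p = q.
Hypothesis m0 : local_min f I0.
Hypothesis m1 : local_min f I1.
Implicit Types (x y p q r : unitI R) (c d : tree_space f).

Local Notation T := (tree_space f).
Local Notation V := (@tree_vertices R f).
Local Notation seg_max := (seg_max cf).
Local Notation tpoint := (@tpoint R f).
Local Notation ht := (@tree_height R f).
Local Notation join := (join cf).
Local Notation fmax := (fmax cf).

Lemma vertexP c : V c <-> exists2 p, critical f p & c = tpoint p (f p).
Proof.
split=> [[z /= [cz zE] <-]|[p cp ->]]; first by exists (val z).1; rewrite // projE zE.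
by exists (epi_point f p (f p)) => //=; rewrite maxxx.
Qed.

Lemma vertex_tpoint p : critical f p -> V (tpoint p (f p)).
Proof. by move=> cp; apply/vertexP; exists p. Qed.

Lemma vertex_inj p q : critical f p -> critical f q ->
  tpoint p (f p) = tpoint q (f q) -> p = q.
Proof. by move=> cp cq /(congr1 ht); rewrite !height_tpoint //; exact: inj. Qed.

Lemma merge_critical x y : f x < seg_max x y -> f y < seg_max x y ->
  exists r, [/\ critical f r, f r = seg_max x y, between x y r, r <> x & r <> y].
Proof.
move=> xm ym; case: (segment_max_cases cf x y) => [h|[h|[r [? ? ? ? ?]]]].
- by rewrite h ltxx in xm.
- by rewrite h ltxx in ym.
- by exists r.
Qed.

Lemma merge_vertex x y : f x < seg_max x y -> f y < seg_max x y -> V (tpoint x (seg_max x y)).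
Proof.
move=> xm ym; have [r [cr rE xyr _ _]] := merge_critical xm ym.
rewrite (_ : tpoint x _ = tpoint r (f r)); first exact: vertex_tpoint.
by rewrite -rE; apply/eq_tpoint; rewrite ?rE; [exact: ltW| |exact: seg_max_between].
Qed.

Lemma critical_top : exists2 r, critical f r & f r = fmax.
Proof.
exists (segment_argmax cf I0 I1) => //; right.
by apply: (@nearW _ (nbhs (segment_argmax cf I0 I1))) => x; exact: le_top.
Qed.

Lemma vertex_top : V (tpoint I0 fmax).
Proof.
have [r cr rt] := critical_top; rewrite (@tpoint_top _ _ cf I0 r _ (lexx fmax)) -rt.
exact: vertex_tpoint.
Qed.

(** The two ends of the interval are critical, so a nearest critical point exists on either side. *)
Lemma critical_neighbours x : ~ critical f x -> exists a b,
  [/\ critical f a, critical f b, val a < val x < val b &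
      forall u : unitI R, val a < val u < val b -> ~ critical f u].
Proof.
move=> ncx.
have finS (P : set (unitI R)) : finite_set (critical f `&` P).
  by apply: sub_finite_set fin; exact: subIsetl.
have [|a [ca ax] amax] := @finite_arg_max R _ _ val (finS [set p | val p < val x]).
  exists I0; split; first by left.
  by apply: (@unitI_lt _ I0 x) (unitI_ge0 x) => x0; apply: ncx; rewrite -x0; left.
have [|b [cb xb] bmin] := @finite_arg_min R _ _ val (finS [set p | val x < val p]).
  exists I1; split; first by left.
  by apply: (@unitI_lt _ x I1) (unitI_le1 x) => x1; apply: ncx; rewrite x1; left.
exists a, b; split=> //; first exact/andP.
move=> u /andP[au ub] cu; case: (ltgtP (val u) (val x)) => [ux|xu|/val_inj ux].
- by have := amax u (conj cu ux); rewrite leNgt au.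
- by have := bmin u (conj cu xu); rewrite leNgt ub.
- by apply: ncx; rewrite -ux.
Qed.

(** Go to the critical neighbour with a value at most [f x]: no critical point lies on the way, so
    the maximum is at an end of the segment. *)
Lemma lower_critical x : exists2 p, critical f p & seg_max p x <= f x.
Proof.
have [cx|ncx] := pselect (critical f x); first by exists x; rewrite ?seg_max_id.
have [a [b [ca cb /andP[ax xb] gap]]] := critical_neighbours ncx.
have axb : val a <= val x <= val b by rewrite !ltW.
case: (gap_min cf gap axb) => h; [exists a => //|exists b => //].
  case: (segment_max_cases cf a x) => [->//|[->//|[z [zb za zx cz _]]]].
  exfalso; apply: (gap z) => //; case/betweenE: zb => /andP[h1 h2]; last by order_lra.
  by rewrite (unitI_lt (nesym za) h1) (le_lt_trans h2).
case: (segment_max_cases cf b x) => [->//|[->//|[z [zb za zx cz _]]]].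
exfalso; apply: (gap z) => //; case/betweenE: zb => /andP[h1 h2]; first by order_lra.
by rewrite (unitI_lt za h2) (lt_le_trans ax).
Qed.

(** * Edges as components of the complement of the vertices *)

Definition cell p q : set T := tpoint p @` `]f p, f q[.

Lemma connected_cell p q : connected (cell p q).
Proof. by apply: connected_tpoint => //; exact: interval_is_interval. Qed.

(** A connected set through [c] that avoids the vertices can neither pass the next vertex above nor
    leave the branch on which [c] lies, since branches separate only at vertices. *)
Lemma component_cell c : ~ V c -> ht c < fmax -> exists p q,
  [/\ critical f p, critical f q, f p < ht c < f q, tpoint q (f q) = tpoint p (f q) &
      connected_component (~` V) c = cell p q].
Proof.
move=> nVc ct; set x := base c; set t := ht c.
have xt : f x <= t by exact: le_base.
have cE : c = tpoint x t by rewrite tpoint_base.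
(* [p] gives the highest vertex below [c], and [q] the lowest vertex on the upward branch of [c]; no
   vertex remains between them on that branch. *)
have [p [cp px] pmax] : exists2 p, (critical f p /\ seg_max p x <= t) &
    forall q, critical f q /\ seg_max q x <= t -> f q <= f p.
  apply: (@finite_arg_max R _ [set p | critical f p /\ seg_max p x <= t]).
    by apply: sub_finite_set fin => ? [].
  by have [p cp pt] := lower_critical x; exists p; split=> //; exact: le_trans xt.
have [q [cq tq qx] qmin] : exists2 q, [/\ critical f q, t < f q & seg_max q x <= f q] &
    forall r, [/\ critical f r, t < f r & seg_max r x <= f r] -> f q <= f r.
  apply: (@finite_arg_min R _ [set q | [/\ critical f q, t < f q & seg_max q x <= f q]]).
    by apply: sub_finite_set fin => ? [].
  by have [r cr rt] := critical_top; exists r; split=> //; rewrite rt //; exact: seg_max_le_top.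
have pt : f p < t.
  rewrite lt_neqAle (le_trans (le_seg_max_l _ _ _) px) andbT; apply/eqP => pt.
  apply: nVc; rewrite (_ : c = tpoint p (f p)); first exact: vertex_tpoint.
  by rewrite cE -pt; apply/eq_tpoint; rewrite ?pt // seg_max_sym.
have pq : seg_max p q <= f q.
  by apply: (seg_max_ultra_le (y := x)); rewrite 1?(seg_max_sym _ _ q) // (le_trans px) // ltW.
have qE : tpoint q (f q) = tpoint p (f q).
  by apply/eq_tpoint; rewrite ?(ltW (lt_trans pt tq)) // seg_max_sym.
exists p, q; split=> //; first by rewrite pt.
have cE' : c = tpoint p t by rewrite cE; apply/eq_tpoint; rewrite ?(ltW pt) // seg_max_sym.
have cellV : cell p q `<=` ~` V.
  move=> _ [s /= + <-]; rewrite in_itv /= => /andP[ps sq] /vertexP[v cv].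
  have [st|ts] := leP s t.
    move=> /(tpoint_inj cf (ltW ps) (lexx _))[sv pv].
    have : f v <= f p.
      apply: pmax; split=> //; apply: (seg_max_ultra_le (y := p)) => //.
      by rewrite seg_max_sym (le_trans pv) -?sv.
    by rewrite -sv leNgt ps.
  move=> /(tpoint_inj cf (ltW ps) (lexx _))[sv pv].
  have : f q <= f v.
    apply: qmin; split; rewrite -?sv //; apply: (seg_max_ultra_le (y := p)).
      by rewrite seg_max_sym sv.
    by rewrite (le_trans px) // ltW.
  by rewrite -sv leNgt sq.
apply/seteqP; split; last first.
  apply: connected_component_max => //; last exact: connected_cell.
  by rewrite cE'; exists t => //=; rewrite in_itv /= pt.
move=> d [C [Cc CV connC] Cd]; set y := base d; set t' := ht d.
have yt' : f y <= t' by exact: le_base.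
have jpc : join p c = t by rewrite cE' join_tpoint ?(ltW pt) // seg_max_id; apply/max_idPl/ltW.
(* To reach or pass height [f q], [C] would have to contain the vertex of [q]. *)
have jq : join p d < f q.
  rewrite ltNge; apply/negP => jq; apply: (CV (tpoint p (f q))).
    by apply: (connected_join connC Cc Cd) jq; rewrite jpc.
  by rewrite -qE; exact: vertex_tpoint.
have jyd : join y d = t' by exact: join_base.
(* If [d] were off the branch of [p], the two branches would meet at a vertex: either inside the
   cell, which contains none, or at the vertex of [p], which [C] would have to cross. *)
have jE : join p d = t'.
  apply/eqP; rewrite eq_le le_join andbT leNgt; apply/negP => tj.
  have jm : join p d = seg_max p y by exact: join_gt.
  have [pj|jp] := ltP (f p) (join p d).
    apply: (cellV (tpoint p (join p d))); first by exists (join p d) => //=; rewrite in_itv /= pj.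
    by rewrite jm; apply: merge_vertex; rewrite -jm // (le_lt_trans yt').
  have {}jp : join p d = f p by apply/eqP; rewrite eq_le jp le_join_base.
  apply: (CV (tpoint y (f p))); last first.
    rewrite (_ : tpoint y _ = tpoint p (f p)); first exact: vertex_tpoint.
    by apply/eq_tpoint; rewrite ?lexx // -?jp ?(le_trans yt' (ltW tj)) // seg_max_sym jm.
  apply: (connected_join connC Cd Cc); first by rewrite jyd -jp.
  by rewrite (le_trans (ltW pt)) // le_join.
have dE : d = tpoint p t' by apply: join_heightP jE.
exists t' => //=; rewrite in_itv /= -{2}jE jq andbT lt_neqAle.
rewrite -{2}jE le_join_base andbT; apply/eqP => pt'.
by apply: (CV d Cd); rewrite dE -pt'; exact: vertex_tpoint.
Qed.

Lemma tree_einfE : @tree_einf R f = [set c | fmax < ht c].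
Proof.
apply/seteqP; split=> c /= h; first exact: h.
by move=> x; exact: le_lt_trans (le_top cf x) h.
Qed.

Lemma einf_gt c : fmax < ht c -> @tree_einf R f c.
Proof. by rewrite tree_einfE. Qed.

Lemma vertex_le_top c : V c -> ht c <= fmax.
Proof. by move=> /vertexP[p cp ->]; rewrite height_tpoint //; exact: le_top. Qed.

Lemma vertex_at_top c : ht c = fmax -> c = tpoint I0 fmax.
Proof. by move=> ct; rewrite -[LHS]tpoint_base ct; exact: tpoint_top. Qed.

Lemma component_einf c : ~ V c -> fmax <= ht c ->
  connected_component (~` V) c = @tree_einf R f.
Proof.
move=> nVc; rewrite le_eqVlt => /orP[/eqP/esym/vertex_at_top cE|tc].
  by case: nVc; rewrite cE; exact: vertex_top.
rewrite tree_einfE; apply/seteqP; split=> [d [C [Cc CV connC] Cd] /=|]; last first.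
  apply: connected_component_max => //.
    by move=> d /= td /vertex_le_top; rewrite leNgt td.
  rewrite (_ : mkset _ = tpoint I0 @` `]fmax, +oo[).
    by apply: connected_tpoint => //; exact: interval_is_interval.
  apply/seteqP; split=> [d /= td|_ [s /= + <-]]; last first.
    by rewrite in_itv /= andbT => ts; rewrite height_tpoint // (le_trans (le_top cf _)) // ltW.
  exists (ht d); first by rewrite /= in_itv /= td.
  by rewrite -[RHS]tpoint_base; apply: (@tpoint_top _ _ cf); exact: ltW.
rewrite ltNge; apply/negP; rewrite le_eqVlt => /orP[/eqP/vertex_at_top dE|dt].
  by apply: (CV d) => //; rewrite dE; exact: vertex_top.
apply: (CV (tpoint (base d) fmax)).
  apply: (connected_join connC Cd Cc); first by rewrite join_base.
  by rewrite (le_trans (ltW tc)) // le_join.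
by rewrite (@tpoint_top _ _ cf _ I0 _ (lexx fmax)); exact: vertex_top.
Qed.

Lemma edges_cases e : @tree_edges R f e -> e = @tree_einf R f \/
  exists p q, [/\ critical f p, critical f q, f p < f q,
    tpoint q (f q) = tpoint p (f q) & e = cell p q].
Proof.
move=> [c nVc <-]; have [ct|tc] := ltP (ht c) fmax; last first.
  by left; exact: component_einf.
right; have [p [q [cp cq /andP[pc cq'] qE eE]]] := component_cell nVc ct.
by exists p, q; split=> //; exact: lt_trans cq'.
Qed.

Lemma edge_einf : @tree_edges R f (@tree_einf R f).
Proof.
have ht1 : ht (tpoint I0 (fmax + 1)) = fmax + 1.
  by rewrite height_tpoint // (le_trans (le_top cf _)) // ler_wpDr.
have nV : ~ V (tpoint I0 (fmax + 1)).
  by move=> /vertex_le_top; rewrite ht1 gerDl ler10.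
by exists (tpoint I0 (fmax + 1)) => //; apply: component_einf; rewrite ?ht1 ?lerDl.
Qed.

Lemma edge_disjoint_vertices e c : @tree_edges R f e -> e c -> ~ V c.
Proof. by move=> [d _ <-] /connected_component_sub. Qed.

Lemma edge_component e c : @tree_edges R f e -> e c ->
  e = connected_component (~` V) c.
Proof. by move=> [d nVd <-] /same_connected_component. Qed.

Lemma edge_nonempty e : @tree_edges R f e -> exists c, e c.
Proof. by move=> [c nVc <-]; exists c; exact: connected_component_refl. Qed.

Lemma edge_eq e e' c : @tree_edges R f e -> @tree_edges R f e' -> e c -> e' c -> e = e'.
Proof. by move=> Ee Ee' ec e'c; rewrite (edge_component Ee ec) (edge_component Ee' e'c). Qed.

(** * The cell complex and the axioms of a merge tree *)

Lemma segment_edge_cell p q : critical f p -> critical f q -> f p < f q ->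
  tpoint q (f q) = tpoint p (f q) -> segment_edge R V (cell p q).
Proof.
move=> cp cq pq qE; pose l (r : R) := f p + r * (f q - f p).
have l_le (s : unitI R) : f p <= l (val s).
  by rewrite lerDl mulr_ge0 ?unitI_ge0 // subr_ge0 ltW.
exists (fun s => tpoint p (l (val s))); split.
- move=> s; apply: (@continuous_comp _ _ _ (val : unitI R -> R) (tpoint p \o l)).
    exact: continuous_unitI_val.
  apply: (@continuous_comp R R _ l (tpoint p)); last exact: continuous_tpoint_height.
  by apply: cvgD; [exact: cvg_cst|apply: cvgM; [exact: cvg_id|exact: cvg_cst]].
- by rewrite /l /= mul0r addr0; exact: vertex_tpoint.
- by rewrite /l /= mul1r addrC subrK -qE; exact: vertex_tpoint.
- move=> s s' _ _ /(tpoint_inj cf (l_le s) (l_le s'))[/addrI + _].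
  have pq0 : f q - f p != 0 by rewrite subr_eq0 gt_eqF.
  by move=> /(mulIf pq0) /val_inj.
- apply/seteqP; split=> [_ [s /andP[s0 s1] <-]|_ [t + <-]].
    exists (l (val s)) => //=; rewrite in_itv /=.
    by rewrite ltrDl mulr_gt0 ?subr_gt0 //= -ltrBrDl gtr_pMl ?subr_gt0.
  rewrite /= in_itv /= => /andP[pt tq]; have d0 : 0 < f q - f p by rewrite subr_gt0.
  have s01 : 0 < (t - f p) / (f q - f p) < 1.
    by rewrite divr_gt0 ?subr_gt0 //= ltr_pdivrMr // mul1r ltrD2r.
  exists (clampI ((t - f p) / (f q - f p))).
    by rewrite /mkset clampIE //; order_lra.
  rewrite clampIE; last by order_lra.
  by rewrite /l divfK ?gt_eqF // addrC subrK.
Qed.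

Lemma ray_edge_einf : ray_edge R V (@tree_einf R f).
Proof.
have le_t (s : halfline R) : fmax <= fmax + val s.
  by rewrite lerDl; have := set_valP s; rewrite /halfline /= in_itv /= andbT.
have f_le x (s : halfline R) : f x <= fmax + val s by exact: le_trans (le_top cf _) (le_t s).
have cval : continuous (val : halfline R -> R) by exact: initial_continuous.
pose l (r : R) : R := fmax + r.
have cmk : continuous (tpoint I0 \o l).
  move=> r; apply: (@continuous_comp R R T l (tpoint I0)).
    by apply: cvgD; [exact: cvg_cst|exact: cvg_id].
  exact: continuous_tpoint_height.
have cphi : continuous (fun s : halfline R => tpoint I0 (fmax + val s)).
  move=> s; apply: (@continuous_comp (halfline R) R T val (tpoint I0 \o l)).
    exact: cval.
  exact: cmk.
have maxH (r : R) : Num.max 0 r \in halfline R.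
  by apply/mem_set; rewrite /halfline /= in_itv /= le_max lexx.
pose clampH (r : R) : halfline R := exist _ (Num.max 0 r) (maxH r).
have cclampH : continuous clampH.
  apply: (continuous_comp_initial (w := set_val)).
  apply: (@max_fun_continuous _ R R (cst 0) id); first exact: cst_continuous.
  by move=> r; exact: cvg_id.
have clampHK (s : halfline R) : clampH (val s) = s.
  apply: val_inj => /=; apply/max_idPr; have := set_valP s.
  by rewrite /halfline /= in_itv /= andbT.
exists (fun s => tpoint I0 (fmax + val s)); split=> //.
- by move=> s s' /(tpoint_inj cf (f_le _ s) (f_le _ s'))[/addrI/val_inj].
- move=> C clC.
  (* The height minus [fmax] is a continuous inverse of the ray, so the image of a closed set is the
     preimage of that set, cut down to heights at least [fmax]. *)
  have -> : (fun s : halfline R => tpoint I0 (fmax + val s)) @` C =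
      [set c | fmax <= ht c] `&` (fun c => clampH (ht c - fmax)) @^-1` C.
    apply/seteqP; split=> [_ [s Cs <-]|c [/= tc Cc]].
      have hE : ht (tpoint I0 (fmax + val s)) = fmax + val s by exact: height_tpoint.
      split; first by rewrite /mkset hE.
      rewrite /preimage /mkset hE.
      by have -> : fmax + val s - fmax = val s; [rewrite addrC addKr|rewrite clampHK].
    exists (clampH (ht c - fmax)) => //=.
    rewrite (max_idPr _) ?subr_ge0 // addrC subrK -[RHS]tpoint_base.
    exact: (@tpoint_top _ _ cf).
  apply: closedI.
    rewrite (_ : mkset _ = ht @^-1` [set t | fmax <= t]) //.
    by apply: closed_comp => [c _|]; [exact: continuous_height|exact: closed_ge].
  apply: closed_comp => // c _.
  apply: (@continuous_comp _ R _ (fun c => ht c - fmax) clampH); last exact: cclampH.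
  by apply: (@continuousB R R^o T ht (fun=> fmax));
    [exact: continuous_height|exact: cst_continuous].
- by rewrite /= addr0; exact: vertex_top.
- rewrite tree_einfE; apply/seteqP; split=> [_ [s s0 <-]|c /= tc].
    by rewrite /mkset (height_tpoint cf (f_le I0 s)) ltrDl.
  exists (clampH (ht c - fmax)); first by rewrite /= lt_max subr_gt0 tc orbT.
  rewrite /= (max_idPr _) ?subr_ge0 ?ltW // addrC subrK -[RHS]tpoint_base.
  exact/(@tpoint_top _ _ cf)/ltW.
Qed.

Lemma finite_cells : finite_set (cells V (@tree_edges R f)).
Proof.
have finV : finite_set V.
  apply: (@sub_finite_set _ _ ((fun p => tpoint p (f p)) @` critical f)).
    by move=> c /vertexP[p cp ->]; exists p.
  exact: finite_image.
have finC : finite_set ((fun pq => cell pq.1 pq.2) @` (critical f `*` critical f)).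
  by apply: finite_image; exact: finite_setX.
apply: (@sub_finite_set _ _ (((@set1 T) @` V) `|` ([set @tree_einf R f] `|`
  ((fun pq => cell pq.1 pq.2) @` (critical f `*` critical f))))).
  move=> e [|/edges_cases[->|[p [q [cp cq _ _ ->]]]]]; first by left.
    by right; left.
  by right; right; exists (p, q).
rewrite !finite_setU; split; first exact: finite_image.
by split=> //; exact: finite_set1.
Qed.

Lemma tree_1complex : locally_finite_1complex R V (@tree_edges R f).
Proof.
split.
- exact: tree_hausdorff.
- split.
  + apply/seteqP; split=> // c _; have [Vc|nVc] := pselect (V c).
      by exists [set c] => //; left; exists c.
    exists (connected_component (~` V) c); first by right; exists c.
    exact: connected_component_refl.
  + move=> e e' [[v Vv <-]|Ee] [[v' Vv' <-]|Ee'] [c [/= ec e'c]].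
    * by rewrite -[v]ec -[v']e'c.
    * by case: (edge_disjoint_vertices Ee' e'c); rewrite ec.
    * by case: (edge_disjoint_vertices Ee ec); rewrite e'c.
    * exact: edge_eq ec e'c.
  + by move=> e [[v Vv <-]|/edge_nonempty//]; exists v.
- move=> e /edges_cases[->|[p [q [cp cq pq qE ->]]]]; [right|left].
    exact: ray_edge_einf.
  exact: segment_edge_cell.
- move=> c; exists setT; first exact: filterT.
  by apply: sub_finite_set finite_cells => e [].
Qed.

(** If the path left the branch of [p], being off it at time [s], then [connected_join] would put
    the meeting point on the path both before and after [s], against injectivity. On the branch a
    point is determined by its height, so the height along the path is continuous and injective,
    hence monotone. *)
Lemma path_to_top_increasing (g : unitI R -> T) : continuous g -> injective g ->
  V (g I0) -> g I1 = tpoint I0 fmax ->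
  {homo ht \o g : s t / val s < val t >-> s < t}.
Proof.
move=> cg ig /vertexP[p cp g0] g1.
have ht1 : ht (g I1) = fmax by rewrite g1 height_tpoint // le_top.
have cimg (a b : R) : 0 <= a -> b <= 1 ->
    connected (g @` [set u : unitI R | a <= val u <= b]).
  move=> a0 b1; apply: connected_continuous_connected.
    exact: connected_unitI_itv.
  exact: continuous_subspaceT.
have gE (s : unitI R) : g s = tpoint p (ht (g s)).
  apply: join_heightP; set d := g s; apply/eqP; rewrite eq_le le_join andbT leNgt.
  apply/negP => dj; have jm := join_gt dj; set a := join p d in dj jm.
  have [s1 s1s g1a] : exists2 s1, val s1 <= val s & g s1 = tpoint p a.
    have [pa|ap] := ltP (f p) a; last first.
      exists I0; first exact: unitI_ge0.
      rewrite g0; congr tpoint; apply/eqP; rewrite eq_le ap andbT.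
      exact: le_join_base.
    have c0s := cimg 0 (val s) (lexx 0) (unitI_le1 s).
    have g0p : join p (g I0) = f p by rewrite g0 join_tpoint // seg_max_id maxxx.
    suff [s1 /andP[_ s1s] s1E] :
        (g @` [set u : unitI R | 0 <= val u <= val s]) (tpoint p a) by exists s1.
    apply: (@connected_join _ _ cf _ p a (g I0) d c0s); rewrite ?g0p //.
      by exists I0 => //; rewrite /mkset lexx unitI_ge0.
    by exists s => //; rewrite /mkset lexx unitI_ge0.
  have [s2 ss2 g2a] : exists2 s2, val s <= val s2 & g s2 = tpoint p a.
    have cs1 := cimg (val s) 1 (unitI_ge0 s) (lexx 1).
    have [s2 /andP[ss2 _] g2] :
        (g @` [set u : unitI R | val s <= val u <= 1]) (tpoint (base d) a).
      apply: (@connected_join _ _ cf _ (base d) a d (g I1) cs1).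
      - by exists s => //; rewrite /mkset lexx unitI_le1.
      - by exists I1 => //; rewrite /mkset lexx unitI_le1.
      - by rewrite join_base.
      - by rewrite (le_trans _ (le_join _ _ _)) // ht1 jm; exact: seg_max_le_top.
    exists s2; rewrite // g2; apply/eq_tpoint.
    - by rewrite (le_trans (le_base d)) // ltW.
    - exact: le_join_base.
    - by rewrite seg_max_sym jm.
  have ss : s1 = s2 by apply: ig; rewrite g1a.
  have sE : s1 = s by apply: val_inj; apply/eqP; rewrite eq_le s1s ss.
  move: dj; rewrite -/(ht d) {1}/d -sE g1a height_tpoint ?ltxx //.
  exact: le_join_base.
have ch : continuous (ht \o g).
  by move=> s; apply: continuous_comp; [exact: cg|exact: continuous_height].
have ih (s t : unitI R) : ht (g s) = ht (g t) -> s = t.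
  by move=> st; apply: ig; rewrite gE st -gE.
have lt_top (s : unitI R) : val s < 1 -> ht (g s) < fmax.
  move=> s1; rewrite ltNge; apply/negP => ts.
  have [|u /andP[_ us] /= uE] := @unitI_IVT _ _ I0 s fmax ch (unitI_ge0 s) => //.
    by rewrite /= ts g0 height_tpoint ?le_top.
  by have := ih u I1; rewrite uE ht1 => /(_ erefl) u1; move: us; rewrite u1 leNgt s1.
move=> s t st; rewrite /= ltNge; apply/negP => ts.
have [|u /andP[tu _] /= /ih us] := @unitI_IVT _ _ t I1 (ht (g s)) ch (unitI_le1 t) => //.
  by rewrite /= ts ht1 ltW ?lt_top // (lt_le_trans st) ?unitI_le1.
by move: tu; rewrite us leNgt st.
Qed.

Lemma tree_is_merge_tree : is_merge_tree (merge_tree_of f).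
Proof.
have ht_top : ht (tpoint I0 fmax) = fmax by rewrite height_tpoint // le_top.
have einfC : ~` @tree_einf R f = [set c | ht c <= fmax].
  by rewrite tree_einfE; apply/seteqP; split=> c /=; rewrite leNgt => /negP.
have closure_ge c : closure (@tree_einf R f) c -> fmax <= ht c.
  rewrite leNgt => cc; apply/negP => ct.
  have [d [/= ]] := cc _ (cvgr_lt _ (@continuous_height _ _ cf c) _ ct).
  by rewrite tree_einfE /= => h /(lt_trans h); rewrite ltxx.
split.
- exact: tree_1complex.
- split; last exact: (contractible_tree cf).
  by apply: (@connected_tree _ _ cf).
- split.
  + exact: edge_einf.
  (* The height is continuous but unbounded on [tree_einf], so on a compact closure it would
     contradict the extreme value theorem. *)
  + move=> cpt; have [|c _ cP] := compact_EVT_max _ cpt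
      (continuous_subspaceT (@continuous_height _ _ cf)).
      have [c ec] := edge_nonempty edge_einf.
      by exists c; exact: subset_closure.
    have tc : fmax < Num.max fmax (ht c) + 1 by rewrite ltr_pwDr // le_max lexx.
    have ct : ht c < Num.max fmax (ht c) + 1 by rewrite ltr_pwDr // le_max lexx orbT.
    have hE : ht (tpoint I0 (Num.max fmax (ht c) + 1)) = Num.max fmax (ht c) + 1.
      by rewrite height_tpoint // (le_trans (le_top cf _)) // ltW.
    have := cP (tpoint I0 (Num.max fmax (ht c) + 1)).
    rewrite hE leNgt ct => /(_ _)/negP; apply=> //.
    by apply/mem_set/subset_closure/einf_gt; rewrite hE.
  + by rewrite /= einfC; exact: (compact_height_le cf).
  + rewrite /= einfC; apply: (@connected_tree _ _ cf) => c /= ct s h.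
    by have cb := le_base c; rewrite (height_tpoint cf); order_lra.
  + rewrite /= einfC; apply: (@contractible_subtree _ _ cf); first by rewrite /= ht_top.
    move=> s c /= ct; rewrite height_contraction /=.
    by have := toward_top_bounds cf s (ht c); order_lra.
- exact: continuous_height.
- exists (tpoint I0 fmax); split.
  + exact: vertex_top.
  + apply/seteqP; split=> [c [/closure_ge tc /vertex_le_top ct]|_ ->].
      by apply: vertex_at_top; apply/eqP; rewrite eq_le ct.
    split; last exact: vertex_top.
    move=> B /(@continuous_tpoint_height _ _ cf I0 fmax)/nbhs_ballP[e /= e0 eB].
    exists (tpoint I0 (fmax + e / 2)); split.
      apply: einf_gt; rewrite height_tpoint ?ltrDl ?divr_gt0 //.
      by rewrite (le_trans (le_top cf _)) // lerDl divr_ge0 // ltW.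
    apply: eB; rewrite /ball /= opprD addrA subrr add0r normrN ger0_norm.
      by rewrite ltr_pdivrMr // ltr_pMr // ltr1n.
    by rewrite divr_ge0 // ltW.
  + rewrite /= ht_top tree_einfE; apply/seteqP; split=> [_ [c /= tc <-]|t].
      by rewrite in_itv /= tc.
    rewrite /= in_itv /= andbT => tt; have htt : ht (tpoint I0 t) = t.
      by rewrite height_tpoint // (le_trans (le_top cf _)) // ltW.
    by exists (tpoint I0 t) => //; apply: einf_gt; rewrite htt.
  + by move=> g cg ig Vg g1; exact: path_to_top_increasing.
Qed.

(** * Strictness and position of the local extrema *)

Lemma near_right_point r (e : R) : 0 < e -> val r < 1 ->
  exists y, val r < val y /\ `|val r - val y| < e.
Proof.
move=> e0 r1; have [d [d0 de dr]] : exists d : R, [/\ 0 < d, d < e & d <= 1 - val r].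
  exists (Num.min (e / 2) (1 - val r)).
  rewrite lt_min gt_min ge_min lexx orbT subr_gt0 r1 divr_gt0 //.
  by rewrite ltr_pdivrMr // ltr_pMr // ltr1n.
have yE : val (clampI (val r + d)) = val r + d.
  by apply: clampIE; have := unitI_ge0 r; order_lra.
by exists (clampI (val r + d)); rewrite yE ltr_norml; order_lra.
Qed.

Lemma near_left_point r (e : R) : 0 < e -> 0 < val r ->
  exists y, val y < val r /\ `|val r - val y| < e.
Proof.
move=> e0 r0; have [d [d0 de dr]] : exists d : R, [/\ 0 < d, d < e & d <= val r].
  exists (Num.min (e / 2) (val r)).
  rewrite lt_min gt_min ge_min lexx orbT r0 divr_gt0 //.
  by rewrite ltr_pdivrMr // ltr_pMr // ltr1n.
have yE : val (clampI (val r - d)) = val r - d.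
  by apply: clampIE; have := unitI_le1 r; order_lra.
by exists (clampI (val r - d)); rewrite yE ltr_norml; order_lra.
Qed.

(** A point with value [f r] inside the neighbourhood where [f r] is maximal is a local maximum too,
    and distinct critical points have distinct values. *)
Lemma local_max_strict r : local_max f r ->
  exists2 e, 0 < e & forall y, `|val r - val y| < e -> y <> r -> f y < f r.
Proof.
move=> rmax; have := rmax; rewrite /local_max -nbhs_nearE => /nbhs_interior.
move=> /nbhs_unitIP[e e0 re]; exists e => // y /re ynear yr.
have yle : f y <= f r by exact: nbhs_singleton ynear.
rewrite lt_neqAle yle andbT; apply/eqP => yE; apply: yr; apply: inj => //; last by right.
by right; rewrite /local_max yE.
Qed.

Lemma local_min_strict r : local_min f r ->
  exists2 e, 0 < e & forall y, `|val r - val y| < e -> y <> r -> f r < f y.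
Proof.
move=> rmin; have := rmin; rewrite /local_min -nbhs_nearE => /nbhs_interior.
move=> /nbhs_unitIP[e e0 re]; exists e => // y /re ynear yr.
have yle : f r <= f y by exact: nbhs_singleton ynear.
rewrite lt_neqAle yle andbT; apply/eqP => yE; apply: yr; apply: inj => //; last by left.
by left; rewrite /local_min -yE.
Qed.

Lemma local_max_not_min r : local_max f r -> ~ local_min f r.
Proof.
move=> /local_max_strict[e e0 re] /local_min_strict[e' e0' re'].
have m0' : 0 < Num.min e e' by rewrite lt_min e0.
have [y [yr]] : exists y, y <> r /\ `|val r - val y| < Num.min e e'.
  have [r1|r1] := ltP (val r) 1.
    have [y [ry ye]] := near_right_point m0' r1.
    by exists y; split=> // yr; rewrite yr ltxx in ry.
  have [y [ry ye]] := near_left_point m0' (lt_le_trans ltr01 r1).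
  by exists y; split=> // yr; rewrite yr ltxx in ry.
rewrite lt_min => /andP[/re/(_ yr) h /re'/(_ yr) /(lt_trans h)].
by rewrite ltxx.
Qed.

(** The ends are local minima, and strictness prevents a point from being both. *)
Lemma local_max_interior r : local_max f r -> 0 < val r < 1.
Proof.
move=> rmax; apply/andP; split.
  apply: (@unitI_lt _ I0) (unitI_ge0 r) => r0.
  by apply: (local_max_not_min rmax); rewrite -r0.
apply: (@unitI_lt _ _ I1) (unitI_le1 r) => r1.
by apply: (local_max_not_min rmax); rewrite r1.
Qed.

(** * Ends of edges, child edges and labels *)

Lemma subset_closure_cell p q (t : R) : f p < f q -> f p <= t <= f q ->
  closure (cell p q) (tpoint p t).
Proof.
move=> pq /andP[pt tq] B /(@continuous_tpoint_height _ _ cf p t)/nbhs_ballP[e /= e0 eB].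
(* Since [d + d < f q - f p], one of [t + d] and [t - d] is strictly between [f p] and [f q], also
   when [t] is an end. *)
pose d := Num.min (e / 2) (f q - f p) / 3.
have m0' : 0 < Num.min (e / 2) (f q - f p) by rewrite lt_min divr_gt0 // subr_gt0.
have d0 : 0 < d by rewrite divr_gt0.
have de : d < e.
  have : Num.min (e / 2) (f q - f p) <= e / 2 by rewrite ge_min lexx.
  by move: m0'; rewrite /d; set m := Num.min _ _ => ? ?; lra.
have dpq : d + d < f q - f p.
  have : Num.min (e / 2) (f q - f p) <= f q - f p by rewrite ge_min lexx orbT.
  by move: m0'; rewrite /d; set m := Num.min _ _ => ? ?; lra.
have [s sE] : exists s, f p < s < f q /\ `|t - s| < e.
  have [tq'|qt] := ltP (t + d) (f q).
    by exists (t + d); split; [|rewrite ltr_norml]; order_lra.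
  by exists (t - d); split; [|rewrite ltr_norml]; order_lra.
case: sE => sb se; exists (tpoint p s); split; last exact: eB.
by exists s; rewrite //= in_itv.
Qed.

Lemma ends_cell p q : @tree_edges R f (cell p q) -> f p < f q ->
  critical f p -> critical f q -> tpoint q (f q) = tpoint p (f q) ->
  ends (T := merge_tree_of f) (cell p q) = [set tpoint q (f q); tpoint p (f p)].
Proof.
move=> Epq pq cp cq qE; apply/seteqP; split=> c.
  move=> [cc nc].
  have : (tpoint p @` `[f p, f q]) c.
    have cl : closed (tpoint p @` `[f p, f q]).
      apply: compact_closed; first exact: tree_hausdorff.
      apply: continuous_compact; last exact: segment_compact.
      exact/continuous_subspaceT/continuous_tpoint_height.
    rewrite [X in X c](closure_id _).1 //; apply: closureS cc => _ [t + <-].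
    by rewrite /= in_itv /= => h; exists t => //=; rewrite in_itv /=; order_lra.
  move=> [t + tE]; rewrite /= in_itv /= => /andP[pt tq].
  have [pt'|] := eqVneq t (f p); first by right; rewrite -tE pt'.
  have [qt'|] := eqVneq t (f q); first by left; rewrite -tE qt' qE.
  move=> tq' tp'; case: nc; rewrite -tE; exists t => //=.
  by rewrite in_itv /= !lt_neqAle pt tq tq' eq_sym tp'.
have vc r : critical f r -> ~ cell p q (tpoint r (f r)).
  by move=> cr /(edge_disjoint_vertices Epq); apply; exact: vertex_tpoint.
move=> [->|->]; split; try exact: vc.
  by rewrite qE; apply: subset_closure_cell => //; rewrite lexx ltW.
by apply: subset_closure_cell => //; rewrite lexx ltW.
Qed.

Lemma child_edgesP v e : @child_edges R (merge_tree_of f) v e -> exists p q,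
  [/\ critical f p, critical f q, f p < f q, tpoint q (f q) = tpoint p (f q) &
      e = cell p q /\ v = tpoint q (f q)].
Proof.
move=> [Ee [w [Vw wv _] eE]]; have [einf|[p [q [cp cq pq qE ec]]]] := edges_cases Ee.
  (* [tree_einf] is no child edge: its ends have height at least [fmax], while a child would be
     strictly lower than a vertex, and vertices have height at most [fmax]. *)
  have ge c : ends (T := merge_tree_of f) e c -> fmax <= ht c.
    move=> [+ _]; rewrite einf => cc; rewrite leNgt; apply/negP => ct.
    have [d []] := cc _ (cvgr_lt _ (@continuous_height _ _ cf c) _ ct).
    by rewrite tree_einfE /= => h /(lt_trans h); rewrite ltxx.
  have vt : fmax <= ht v by apply: ge; rewrite eE; left.
  have wt : fmax <= ht w by apply: ge; rewrite eE; right.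
  have Vv : V v.
    have : ends (T := merge_tree_of f) e v by rewrite eE; left.
    move=> [_]; rewrite einf tree_einfE /= => /negP; rewrite -leNgt => tv.
    rewrite (vertex_at_top (c := v)); first exact: vertex_top.
    by apply/eqP; rewrite eq_le tv.
  have := vertex_le_top Vv => tv.
  by have := lt_le_trans (le_lt_trans wt wv) tv; rewrite ltxx.
exists p, q; split=> //; split=> //; rewrite ec in Ee eE.
have vE : ends (T := merge_tree_of f) (cell p q) v by rewrite eE; left.
have wE : ends (T := merge_tree_of f) (cell p q) w by rewrite eE; right.
have hp : ht (tpoint p (f p)) = f p by rewrite height_tpoint.
have hq : ht (tpoint q (f q)) = f q by rewrite height_tpoint.
rewrite ends_cell // in vE wE; case: vE => // vp; exfalso; move: wv; case: wE => /= ->.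
  by rewrite vp /= hp hq ltNge ltW.
by rewrite vp ltxx.
Qed.

Lemma cell_child p q : @tree_edges R f (cell p q) -> f p < f q ->
  critical f p -> critical f q -> tpoint q (f q) = tpoint p (f q) ->
  @children R (merge_tree_of f) (tpoint q (f q)) (tpoint p (f p)) /\
  @child_edges R (merge_tree_of f) (tpoint q (f q)) (cell p q).
Proof.
move=> Epq pq cp cq qE; have eE := ends_cell Epq pq cp cq qE.
have ch : @children R (merge_tree_of f) (tpoint q (f q)) (tpoint p (f p)).
  split; first exact: vertex_tpoint.
    by rewrite /= !height_tpoint.
  by exists (cell p q).
by split=> //; split=> //; exists (tpoint p (f p)).
Qed.

(** A representative of a point of the cell is joined to [p] below height [f q], so the segment
    between them cannot contain [q]. *)
Lemma cell_left p q (z : epigraph f) : f p < f q -> tpoint q (f q) = tpoint p (f q) ->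
  val p < val q -> cell p q (tree_proj z) -> val (val z).1 < val q.
Proof.
move=> pq qE ltpq [s sI sE].
have /andP[ps sq] : f p < s < f q by move: sI; rewrite /= in_itv.
have zle : f (val z).1 <= (val z).2 by have := set_valP z.
move: sE; rewrite projE => /(tpoint_inj cf (ltW ps) zle)[zs pz].
rewrite ltNge; apply/negP => qz.
have : f q <= seg_max p (val z).1 by apply: le_seg_max; apply/betweenE; left; order_lra.
by move=> /le_trans/(_ pz); rewrite -zs leNgt sq.
Qed.

Lemma cell_right p q (z : epigraph f) : f p < f q -> tpoint q (f q) = tpoint p (f q) ->
  val q < val p -> cell p q (tree_proj z) -> val q < val (val z).1.
Proof.
move=> pq qE ltpq [s sI sE].
have /andP[ps sq] : f p < s < f q by move: sI; rewrite /= in_itv.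
have zle : f (val z).1 <= (val z).2 by have := set_valP z.
move: sE; rewrite projE => /(tpoint_inj cf (ltW ps) zle)[zs pz].
rewrite ltNge; apply/negP => qz.
have : f q <= seg_max p (val z).1 by apply: le_seg_max; apply/betweenE; right; order_lra.
by move=> /le_trans/(_ pz); rewrite -zs leNgt sq.
Qed.

(** A maximum equal to [f q] would be attained at a critical point of the same value, hence at [q]
    itself. *)
Lemma seg_max_lt_critical x y q : critical f q -> ~ between x y q ->
  f x < f q -> f y < f q -> seg_max x y <= f q -> seg_max x y < f q.
Proof.
move=> cq nq xq yq; rewrite le_eqVlt => /orP[/eqP|//] m.
case: (segment_max_cases cf x y) => [->//|[->//|[z [zb _ _ cz zE]]]].
by case: nq; rewrite (inj cq cz) // zE m.
Qed.

Lemma edge_below q y : critical f q -> f y < f q -> seg_max y q <= f q ->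
  exists p, [/\ critical f p, f p < f q, tpoint q (f q) = tpoint p (f q),
                @tree_edges R f (cell p q) & seg_max p y < f q].
Proof.
move=> cq yq myq.
(* A height above [f y] and above all critical values below [f q]: the edge through [tpoint y t] can
   then end only at [q]. *)
have [t [yt tq tcrit]] : exists t, [/\ f y < t, t < f q &
    forall v, critical f v -> f v < f q -> f v < t].
  pose A := [set v | v = y \/ (critical f v /\ f v < f q)].
  have [a Aa amax] : exists2 a, A a & forall b, A b -> f b <= f a.
    apply: finite_arg_max; last by exists y; left.
    apply: (@sub_finite_set _ _ ([set y] `|` critical f)).
      by move=> v [->|[cv _]]; [left|right].
    by rewrite finite_setU; split => //; exact: finite_set1.
  have aq : f a < f q by case: Aa => [->|[]].
  have ya : f y <= f a by apply: amax; left.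
  exists ((f a + f q) / 2); split; [lra|lra|move=> v cv vq].
  have va : f v <= f a by apply: amax; right.
  lra.
have ht_t : ht (tpoint y t) = t by rewrite height_tpoint // ltW.
have nV : ~ V (tpoint y t).
  move=> /vertexP[v cv] /(tpoint_inj cf (ltW yt) (lexx _))[tv _].
  by have := tcrit v cv; rewrite -tv ltxx => /(_ tq).
have [|p [q' [cp cq' + qE eE]]] := component_cell nV.
  by rewrite ht_t (lt_le_trans tq) // le_top.
rewrite ht_t => /andP[pt tq'].
have Ec : @tree_edges R f (cell p q') by exists (tpoint y t).
have [s + sE] : cell p q' (tpoint y t) by rewrite -eE; exact: connected_component_refl.
rewrite /= in_itv /= => /andP[ps sq].
have [st mpy] := tpoint_inj cf (ltW ps) (ltW yt) sE.
have pq : f p < f q by exact: lt_trans tq.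
have mpq : seg_max p q <= f q.
  by apply: (seg_max_ultra_le (y := y)) => //; rewrite (le_trans mpy) // ltW.
have qqE : tpoint q (f q) = tpoint p (f q) by apply/eq_tpoint; rewrite ?(ltW pq) // seg_max_sym.
(* A lower [q'] would have a critical value between [t] and [f q]; a higher one would place the
   vertex of [q] inside the edge. *)
have qq' : q' = q.
  apply: inj => //; case: (ltgtP (f q') (f q)) => // h.
    by have := lt_trans tq' (tcrit _ cq' h); rewrite ltxx.
  have : cell p q' (tpoint q (f q)) by rewrite qqE; exists (f q); rewrite //= in_itv /= pq.
  by move=> /(edge_disjoint_vertices Ec) []; exact: vertex_tpoint.
by rewrite qq' in Ec; exists p; split=> //; exact: le_lt_trans mpy tq.
Qed.

(** As [q] is not between them, [p] and [p'] are joined strictly below [f q]; from there up to [f q]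
    the two cells run together. *)
Lemma same_side_cells p p' q : critical f p -> critical f p' -> critical f q ->
  @tree_edges R f (cell p q) -> @tree_edges R f (cell p' q) ->
  f p < f q -> f p' < f q -> tpoint q (f q) = tpoint p (f q) -> tpoint q (f q) = tpoint p' (f q) ->
  ~ between p p' q -> cell p q = cell p' q.
Proof.
move=> cp cp' cq Ep Ep' pq pq' qE qE' nb.
have /(tpoint_inj cf (lexx _) (ltW pq))[_ m] := qE.
have /(tpoint_inj cf (lexx _) (ltW pq'))[_ m'] := qE'.
have mpp : seg_max p p' <= f q by apply: (seg_max_ultra_le (y := q)); rewrite // seg_max_sym.
have lt_mpp := seg_max_lt_critical cq nb pq pq' mpp.
have mp := le_seg_max_l cf p p'; have mp' := le_seg_max_r cf p p'.
pose s := (seg_max p p' + f q) / 2.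
have [ms sq] : seg_max p p' < s /\ s < f q by rewrite /s; lra.
apply: (edge_eq (c := tpoint p s) Ep Ep'); first by exists s; rewrite //= in_itv /=; order_lra.
exists s; first by rewrite /= in_itv /=; order_lra.
by apply/eq_tpoint; rewrite 1?seg_max_sym; lra.
Qed.

(** The segment towards [p] contains points close to [q], where the strict minimum is already
    exceeded. *)
Lemma local_min_barrier p q : local_min f q -> p <> q -> f q < seg_max p q.
Proof.
move=> /local_min_strict[e e0 eq] npq.
have [y [yb yq ye]] : exists y, [/\ between q p y, y <> q & `|val q - val y| < e].
  case: (ltgtP (val p) (val q)) => [pq'|qp|/val_inj//].
    have e0' : 0 < Num.min e (val q - val p) by rewrite lt_min e0 subr_gt0.
    have [y [yq]] := near_left_point e0' (le_lt_trans (unitI_ge0 p) pq').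
    rewrite lt_min => /andP[ye]; rewrite ltr_norml => h; exists y; split=> //.
      by apply/betweenE; right; order_lra.
    by move=> h'; rewrite h' ltxx in yq.
  have e0' : 0 < Num.min e (val p - val q) by rewrite lt_min e0 subr_gt0.
  have [y [yq]] := near_right_point e0' (lt_le_trans qp (unitI_le1 p)).
  rewrite lt_min => /andP[ye]; rewrite ltr_norml => h; exists y; split=> //.
    by apply/betweenE; left; order_lra.
  by move=> h'; rewrite h' ltxx in yq.
by rewrite seg_max_sym; apply: lt_le_trans (le_seg_max cf yb); exact: eq.
Qed.

Lemma cell_below_max p q : critical f p -> critical f q -> f p < f q ->
  tpoint q (f q) = tpoint p (f q) -> local_max f q.
Proof.
move=> cp cq pq qE; case: (cq) => // /local_min_barrier qmin.
have /(tpoint_inj cf (lexx _) (ltW pq))[_] := qE.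
by rewrite seg_max_sym leNgt qmin // => h; rewrite h ltxx in pq.
Qed.

(** [edge_below] is applied to a point on each side of [q], so close that [f] does not exceed [f q]
    on the way. The lower vertex is joined to that point below [f q], hence lies on the same
    side. *)
Lemma children_of_max q : critical f q -> local_max f q -> exists pL pR,
  [/\ [/\ critical f pL, f pL < f q, tpoint q (f q) = tpoint pL (f q) & @tree_edges R f (cell pL q)],
      [/\ critical f pR, f pR < f q, tpoint q (f q) = tpoint pR (f q) & @tree_edges R f (cell pR q)] &
      val pL < val q < val pR].
Proof.
move=> cq qmax; have [e e0 qe] := local_max_strict qmax.
have /andP[q0 q1] := local_max_interior qmax.
have mle y : `|val q - val y| < e -> seg_max y q <= f q.
  move=> ye; apply/seg_max_le => z /betweenE zb.
  have [->//|zq] := pselect (z = q); apply/ltW/qe => //.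
  by rewrite ltr_norml; rewrite ltr_norml in ye; order_lra.
have side y p : seg_max p y < f q -> ~ between p y q.
  by move=> m /(le_seg_max cf); rewrite leNgt m.
have [y [yq ye]] := near_left_point e0 q0.
have nyq : y <> q by move=> h; rewrite h ltxx in yq.
have [pL [cL Lq LE EL mL]] := edge_below cq (qe _ ye nyq) (mle _ ye).
have [y' [yq' ye']] := near_right_point e0 q1.
have nyq' : y' <> q by move=> h; rewrite h ltxx in yq'.
have [pR [cR Rq RE ER mR]] := edge_below cq (qe _ ye' nyq') (mle _ ye').
exists pL, pR; split=> //; apply/andP; split; rewrite ltNge; apply/negP => h.
  by apply: (side _ _ mL); apply/betweenE; order_lra.
by apply: (side _ _ mR); apply/betweenE; order_lra.
Qed.

Lemma child_edges_of_vertex v : V v -> child_edges (T := merge_tree_of f) v !=set0 ->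
  exists pL pR q,
  [/\ [/\ critical f q, v = tpoint q (f q) & tpoint pL (f pL) <> tpoint pR (f pR)],
      forall z : epigraph f, cell pL q (tree_proj z) -> val (val z).1 < val q,
      forall z : epigraph f, cell pR q (tree_proj z) -> val q < val (val z).1,
      child_edges (T := merge_tree_of f) v = [set cell pL q; cell pR q] &
      children (T := merge_tree_of f) v = [set tpoint pL (f pL); tpoint pR (f pR)]].
Proof.
move=> Vv [_ /child_edgesP[p [q [cp cq pq qE [_ vE]]]]].
have qmax := cell_below_max cp cq pq qE.
have [pL [pR [[cL Lq LE EL] [cR Rq RE ER] /andP[Lq' qR']]]] := children_of_max cq qmax.
have chE : child_edges (T := merge_tree_of f) v = [set cell pL q; cell pR q].
  apply/seteqP; split=> e; last first.
    by rewrite vE => -[->|->]; [have [] := cell_child EL Lq cL cq LE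
                               |have [] := cell_child ER Rq cR cq RE].
  move=> he; have [p' [q' [cp' cq' pq' qE' [eE vE']]]] := child_edgesP he.
  have qq' : q' = q by apply: vertex_inj => //; rewrite -vE'.
  rewrite qq' in pq' qE' eE; have Ee : @tree_edges R f e by case: he.
  (* Any child edge starts on one side of [q] and so coincides with the edge already found there. *)
  rewrite eE in Ee *; case: (ltgtP (val p') (val q)) => [h|h|/val_inj h].
  - left; apply: same_side_cells => //; move/betweenE; order_lra.
  - right; apply: same_side_cells => //; move/betweenE; order_lra.
  - by rewrite h ltxx in pq'.
exists pL, pR, q; split.
- split=> //; move=> /(vertex_inj cL cR) LR.
  by have := lt_trans Lq' qR'; rewrite LR ltxx.
- by move=> z; exact: cell_left.
- by move=> z; exact: cell_right.
- exact: chE.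
- apply/seteqP; split=> w; last first.
    by rewrite vE => -[->|->]; [have [] := cell_child EL Lq cL cq LE
                               |have [] := cell_child ER Rq cR cq RE].
  move=> hw; have [Vw wv [e Ee eE]] := hw.
  have he : child_edges (T := merge_tree_of f) v e by split=> //; exists w.
  have wE : ends (T := merge_tree_of f) e w by rewrite eE; right.
  have nwq : w <> tpoint q (f q) by move=> h; move: wv; rewrite vE h ltxx.
  by move: he; rewrite chE => -[eL|eR]; [left|right]; move: wE;
    rewrite ?eL ?eR ends_cell // => -[].
Qed.

Lemma label_of_vertex v pL pR q :
  (forall z : epigraph f, cell pL q (tree_proj z) -> val (val z).1 < val q) ->
  (forall z : epigraph f, cell pR q (tree_proj z) -> val q < val (val z).1) ->
  child_edges (T := merge_tree_of f) v = [set cell pL q; cell pR q] ->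
  tree_label v (cell pL q) = Left /\ tree_label v (cell pR q) = Right.
Proof.
move=> hL hR chE.
have repr_edge e : child_edges (T := merge_tree_of f) v e ->
    exists z : epigraph f, e (tree_proj z).
  move=> [Ee _]; have [c ec] := edge_nonempty Ee.
  by exists (epi_point f (base c) (ht c)); rewrite (_ : tree_proj _ = c) //; exact: tpoint_base.
have [zL LzL] : exists z : epigraph f, cell pL q (tree_proj z).
  by apply: repr_edge; rewrite chE; left.
have [zR RzR] : exists z : epigraph f, cell pR q (tree_proj z).
  by apply: repr_edge; rewrite chE; right.
rewrite /tree_label; split.
  case: ifPn => // /asboolPn[]; exists (cell pR q); rewrite chE; split; first by right.
  by move=> z w /hL zq /hR; exact: lt_trans.
(* The right edge is not to the left of the left one, nor, being nonempty, of itself. *)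
case: ifPn => // /asboolP[e [+ lo]]; rewrite chE => -[eE|eE].
  have := lo zR zL RzR; rewrite eE => /(_ LzL) h.
  by have := lt_trans (lt_trans (hL _ LzL) (hR _ RzR)) h; rewrite ltxx.
by have := lo zR zR RzR; rewrite eE ltxx => /(_ RzR).
Qed.

Lemma tree_is_chiral : is_chiral_merge_tree (chiral_merge_tree_of f).
Proof.
split; first exact: tree_is_merge_tree.
move=> v Vv [w hw].
have [|pL [pR [q [[cq vE LR] hL hR chE cE]]]] := child_edges_of_vertex Vv.
  by have [_ _ [e Ee eE]] := hw; exists e; split=> //; exists w.
have [lL lR] := label_of_vertex hL hR chE.
split; first by exists (tpoint pL (f pL)), (tpoint pR (f pR)).
by exists (cell pL q), (cell pR q).
Qed.

(** The child edge of [r] over [p] may start at another critical point [q], but above [seg_max q p]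
    the branches of [p] and [q] agree. *)
Lemma edge_above p r : critical f r -> f p < f r -> seg_max p r <= f r ->
  exists e s, [/\ child_edges (T := merge_tree_of f) (tpoint r (f r)) e,
                 f p <= s & e (tpoint p s)].
Proof.
move=> cr pr mpr; have [q [cq qr qE Eq mqp]] := edge_below cr pr mpr.
exists (cell q r), ((seg_max q p + f r) / 2); split.
- by have [] := cell_child Eq qr cq cr qE.
- by have := le_seg_max_r cf q p; lra.
- exists ((seg_max q p + f r) / 2).
    by have := le_seg_max_l cf q p; rewrite /= in_itv /=; order_lra.
  by apply/eq_tpoint; have := le_seg_max_r cf q p; have := le_seg_max_l cf q p; lra.
Qed.

Lemma label_side r e : critical f r ->
  child_edges (T := merge_tree_of f) (tpoint r (f r)) e -> forall z : epigraph f,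
  e (tree_proj z) ->
  if tree_label (tpoint r (f r)) e is Left then val (val z).1 < val r
  else val r < val (val z).1.
Proof.
move=> cr he z ez; have [|pL [pR [q [[cq vE LR] hL hR chE cE]]]] :=
  child_edges_of_vertex (vertex_tpoint cr); first by exists e.
have [lL lR] := label_of_vertex hL hR chE; rewrite (vertex_inj cr cq vE).
rewrite (vertex_inj cr cq vE) in lL lR he.
move: he; rewrite -vE chE (vertex_inj cr cq vE).
by move=> -[eE|eE]; rewrite eE ?lL ?lR in ez *; [exact: hL|exact: hR].
Qed.

(** * The order of the tree and its vertices *)

Lemma below_tpoint x y s t : f x <= s -> f y <= t ->
  below (T := merge_tree_of f) (tpoint x s) (tpoint y t) <-> s <= t /\ seg_max x y <= t.
Proof.
move=> xs yt; split=> [[C [cC Cx Cy Cle]]|[st xyt]].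
  have st : s <= t by have := Cle _ Cx; rewrite /= !height_tpoint.
  split=> //; rewrite leNgt; apply/negP => txy.
  (* Any height strictly between works: [C] must follow the branch of [x] up to where it meets that
     of [y], which takes it above [t]. *)
  pose a := (t + seg_max x y) / 2; have [ta axy] : t < a /\ a < seg_max x y by rewrite /a; lra.
  have : C (tpoint x a).
    apply: (@connected_join _ _ cf C x a _ _ cC Cx Cy).
      by rewrite join_tpoint // seg_max_id (max_idPl xs); lra.
    by rewrite join_tpoint // le_max (ltW axy) orbT.
  by move=> /Cle; rewrite /= !height_tpoint // ?(leNgt a) ?ta //; lra.
exists (tpoint x @` `[s, t]); split.
- by apply: connected_tpoint => //; exact: interval_is_interval.
- by exists s; rewrite //= in_itv /= lexx.
- exists t; first by rewrite /= in_itv /= lexx st.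
  by apply/eq_tpoint; rewrite ?(le_trans xs).
- move=> _ [u + <-]; rewrite /= in_itv /= => /andP[su ut].
  by rewrite !height_tpoint // (le_trans xs).
Qed.

(** Leaves are the minimal points, and merges are the points where the branches of two strictly
    lower points first meet. Only [below] and the height occur, so the description passes through
    any homeomorphism that preserves heights. *)
Lemma vertex_below c : V c <->
  (forall d, below (T := merge_tree_of f) d c -> d = c) \/
  (exists d d', [/\ below (T := merge_tree_of f) d c,
     below (T := merge_tree_of f) d' c, d <> c, d' <> c &
     forall e, below (T := merge_tree_of f) d e ->
       below (T := merge_tree_of f) d' e -> ht c <= ht e]).
Proof.
split=> [/vertexP[r cr ->]|].
  case: (cr) => [rmin|rmax]; [left|right].
    move=> d; have [y [s [ys ->]]] := tpointP d => /(below_tpoint ys (lexx _))[sr yr].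
    have yr' : y = r.
      apply: contrapT => yr'; have := local_min_barrier rmin yr'.
      by rewrite ltNge yr.
    by rewrite yr' in ys *; congr tpoint; apply/eqP; rewrite eq_le sr.
  have [pL [pR [[cL Lr LE EL] [cR Rr RE ER] /andP[Lr' rR']]]] := children_of_max cr rmax.
  have /(tpoint_inj cf (lexx _) (ltW Lr))[_] := LE; rewrite seg_max_sym => mL.
  have /(tpoint_inj cf (lexx _) (ltW Rr))[_] := RE; rewrite seg_max_sym => mR.
  exists (tpoint pL (f pL)), (tpoint pR (f pR)); split.
  - by apply/below_tpoint => //; rewrite ltW.
  - by apply/below_tpoint => //; rewrite ltW.
  - by move=> /(vertex_inj cL cr) h; rewrite h ltxx in Lr.
  - by move=> /(vertex_inj cR cr) h; rewrite h ltxx in Rr.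
  - move=> e; have [y [s [ys ->]]] := tpointP e.
    move=> /(below_tpoint (lexx _) ys)[_ mLy] /(below_tpoint (lexx _) ys)[_ mRy].
    rewrite !height_tpoint //; apply: (@le_trans _ _ (seg_max pL pR)).
      by apply: le_seg_max; apply/betweenE; left; order_lra.
    by apply: (seg_max_ultra_le (y := y)); rewrite // seg_max_sym.
have [x [a [xa cE]]] := tpointP c; have hc : ht c = a by rewrite cE height_tpoint.
move=> [cmin|[d [d' [dc d'c nd nd' cjoin]]]].
  have [p cp px] := lower_critical x; rewrite -(cmin (tpoint p (f p))).
    exact: vertex_tpoint.
  rewrite cE; apply/below_tpoint => //; rewrite (le_trans px xa); split=> //.
  exact: le_trans (le_seg_max_l _ _ _) (le_trans px xa).
have [y [s [ys dE]]] := tpointP d; have [y' [s' [ys' d'E]]] := tpointP d'.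
move: dc d'c; rewrite cE dE d'E.
move=> /(below_tpoint ys xa)[sa yx] /(below_tpoint ys' xa)[sa' yx'].
have {}sa : s < a.
  rewrite lt_neqAle sa andbT; apply/eqP => sE; apply: nd; rewrite dE cE sE.
  by apply/eq_tpoint => //; rewrite -sE.
have {}sa' : s' < a.
  rewrite lt_neqAle sa' andbT; apply/eqP => sE; apply: nd'; rewrite d'E cE sE.
  by apply/eq_tpoint => //; rewrite -sE.
have myy : seg_max y y' <= a by apply: (seg_max_ultra_le (y := x)); rewrite // seg_max_sym.
(* The branches of [d] and [d'] meet at height [t], so [a <= t]; as [s] and [s'] are below [a], it
   is the maximum over the segment that reaches [a]. *)
pose t := Num.max s (Num.max s' (seg_max y y')).
have yt : f y <= t by rewrite le_max ys.
have amyy : a <= seg_max y y'.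
  have := cjoin (tpoint y t); rewrite hc height_tpoint // dE d'E.
  have -> : (a <= t) = (a <= seg_max y y') by rewrite /t !le_max !(leNgt a) sa sa'.
  apply; first by apply/below_tpoint; rewrite // seg_max_id yt le_max lexx.
  apply/below_tpoint => //; rewrite seg_max_sym !le_max !lexx ?orbT.
  by [].
have {amyy}aE : seg_max y y' = a by apply/eqP; rewrite eq_le myy.
have -> : tpoint x a = tpoint y (seg_max y y').
  by rewrite aE; apply/eq_tpoint => //; [exact: le_trans ys (ltW sa)|rewrite seg_max_sym].
by apply: merge_vertex; rewrite aE; [exact: le_lt_trans sa|exact: le_lt_trans sa'].
Qed.

End nice_function.

(** * Functions with matching critical points *)

(** The preimages of [val (phi x) - e] and [val (phi x) + e] bound a neighbourhood of [x]; a bound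
    outside the unit interval holds trivially. *)
Lemma increasing_bijection_continuous (R : realType) (phi psi : unitI R -> unitI R) :
  {homo phi : x y / val x < val y} -> {homo psi : x y / val x < val y} ->
  cancel phi psi -> cancel psi phi -> continuous phi.
Proof.
move=> phi_lt psi_lt phiK psiK; apply: continuous_to_unitI => x.
apply/(@cvgrPdist_lt _ R^o _ (nbhs x)) => e e0.
have lo : \forall z \near x, val (phi x) - e < val (phi z).
  have [neg|pos] := ltP (val (phi x) - e) 0.
    by apply: (@nearW _ (nbhs x)) => z; exact: lt_le_trans neg (unitI_ge0 _).
  have lE : val (clampI (val (phi x) - e)) = val (phi x) - e.
    by apply: clampIE; have := unitI_le1 (phi x); order_lra.
  have lx : val (psi (clampI (val (phi x) - e))) < val x.
    by rewrite -[in ltRHS](phiK x); apply: psi_lt; rewrite lE ltrBlDr ltrDl.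
  apply/nbhs_unitIP; exists (val x - val (psi (clampI (val (phi x) - e)))).
    by rewrite subr_gt0.
  move=> z; rewrite ltr_norml => /andP[_ xz].
  rewrite -lE -(psiK (clampI _)); apply: phi_lt.
  by move: xz; set p := val (psi _) => ?; lra.
have hi : \forall z \near x, val (phi z) < val (phi x) + e.
  have [big|small] := ltP 1 (val (phi x) + e).
    by apply: (@nearW _ (nbhs x)) => z; exact: le_lt_trans (unitI_le1 _) big.
  have lE : val (clampI (val (phi x) + e)) = val (phi x) + e.
    by apply: clampIE; have := unitI_ge0 (phi x); order_lra.
  have lx : val x < val (psi (clampI (val (phi x) + e))).
    by rewrite -[in ltLHS](phiK x); apply: psi_lt; rewrite lE ltrDl.
  apply/nbhs_unitIP; exists (val (psi (clampI (val (phi x) + e))) - val x).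
    by rewrite subr_gt0.
  move=> z; rewrite ltr_norml => /andP[xz _].
  rewrite -lE -(psiK (clampI _)); apply: phi_lt.
  by move: xz; set p := val (psi _) => ?; lra.
apply: filterS2 lo hi => z lo hi; rewrite ltr_norml.
by apply/andP; split; lra.
Qed.

(* All that the proof uses of [admissible]. *)
Definition nice (R : realType) (f : unitI R -> R) :=
  [/\ continuous f, finite_set (critical f),
      forall p q, critical f p -> critical f q -> f p = f q -> p = q,
      local_min f I0 & local_min f I1].

(** A relation and not a function, so that exchanging [f] and [g] only flips its arguments. *)
Definition critical_matching (R : realType) (f g : unitI R -> R)
    (S : unitI R -> unitI R -> Prop) :=
  [/\ forall p q, S p q -> [/\ critical f p, critical g q & f p = g q],
      forall p, critical f p -> exists q, S p q,
      forall q, critical g q -> exists p, S p q &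
      forall p q p' q', S p q -> S p' q' ->
        (val p < val p') = (val q < val q')].

Lemma critical_matching_sym (R : realType) (f g : unitI R -> R) S :
  critical_matching f g S -> critical_matching g f (fun q p => S p q).
Proof.
move=> [S1 S2 S3 S4]; split=> //; first by move=> q p /S1[].
by move=> q p q' p' Spq Spq'; rewrite (S4 _ _ _ _ Spq Spq').
Qed.

(** Equal values and equal position among the matched critical points; strict monotonicity between
    these leaves only one partner for each point. *)
Definition matched (R : realType) (f g : unitI R -> R)
    (S : unitI R -> unitI R -> Prop) (x y : unitI R) :=
  f x = g y /\ forall p q, S p q ->
    (val p < val x) = (val q < val y) /\ (val x < val p) = (val y < val q).

Section matching.
Variables (R : realType) (f g : unitI R -> R) (S : unitI R -> unitI R -> Prop).
Hypotheses (nf : nice f) (ng : nice g) (fgS : critical_matching f g S).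
Implicit Types x y p q : unitI R.

Let cf : continuous f. Proof. by case: nf. Qed.
Let cg : continuous g. Proof. by case: ng. Qed.
Let inj_f p q : critical f p -> critical f q -> f p = f q -> p = q.
Proof. by case: nf => _ _ + _ _; exact. Qed.
Let inj_g p q : critical g p -> critical g q -> g p = g q -> p = q.
Proof. by case: ng => _ _ + _ _; exact. Qed.

Lemma matching_gap a b a' b' : S a a' -> S b b' ->
  (forall u : unitI R, val a < val u < val b -> ~ critical f u) ->
  forall u : unitI R, val a' < val u < val b' -> ~ critical g u.
Proof.
have [_ _ S3 S4] := fgS => Sa Sb gap u /andP[au ub] cu.
have [p Sp] := S3 _ cu; have [cp _ _] := let: And4 S1 _ _ _ := fgS in S1 _ _ Sp.
by apply: (gap p) => //; rewrite (S4 _ _ _ _ Sa Sp) au (S4 _ _ _ _ Sp Sb).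
Qed.

Lemma gap_strict (F : unitI R -> R) (a b x : unitI R) : nice F ->
  (forall u : unitI R, val a < val u < val b -> ~ critical F u) ->
  val a < val x < val b -> (F a < F x < F b) \/ (F b < F x < F a).
Proof.
move=> [cF _ injF _ _] gap /andP[ax xb]; case: (leP (F a) (F b)) => Fab; [left|right].
  by rewrite (gap_increasing cF injF gap Fab _ ax) ?(gap_increasing cF injF gap Fab _ xb) // ltW.
have Fab' := ltW Fab.
by rewrite (gap_decreasing cF injF gap Fab' _ ax) ?(gap_decreasing cF injF gap Fab' _ xb) // ltW.
Qed.

(** A noncritical [x] lies in a gap; the intermediate value theorem finds [y] in the corresponding
    gap, and as [f x] lies strictly between the end values, [y] avoids the ends. *)
Lemma matched_exists x : exists y, matched f g S x y.
Proof.
have [S1 S2 S3 S4] := fgS; have [cx|ncx] := pselect (critical f x).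
  have [q Sxq] := S2 _ cx; exists q; split; first by case: (S1 _ _ Sxq).
  by move=> p q' Spq; split; exact: S4.
have [_ fin_f _ m0 m1] := nf.
have [a [b [ca cb /andP[ax xb] gap]]] := critical_neighbours fin_f m0 m1 ncx.
have [a' Sa] := S2 _ ca; have [b' Sb] := S2 _ cb.
have [_ _ fa] := S1 _ _ Sa; have [_ _ fb] := S1 _ _ Sb.
have ab' : val a' < val b' by rewrite -(S4 _ _ _ _ Sa Sb) (lt_trans ax).
have xab : val a < val x < val b by rewrite ax.
have gs := gap_strict nf gap xab.
have [|y /andP[ay yb] gy] := unitI_IVT (v := f x) cg (ltW ab').
  by rewrite -fa -fb; case: gs => /andP[/ltW -> /ltW ->]; rewrite ?orbT.
have ay' : val a' < val y.
  by apply: unitI_lt ay => h; move: gs; rewrite -gy -h fa ltxx andbF => -[].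
have yb' : val y < val b'.
  by apply: unitI_lt yb => h; move: gs; rewrite -gy h fb ltxx andbF => -[].
exists y; split=> // p q Spq; have [cp _ _] := S1 _ _ Spq.
case: (ltgtP (val p) (val x)) => [px|xp|/val_inj px]; last by rewrite -px in ncx.
  have pa : ~~ (val a < val p).
    by apply/negP => ap; apply: (gap p); rewrite ?ap ?(lt_trans px).
  have qa : val q <= val a' by rewrite leNgt -(S4 _ _ _ _ Sa Spq).
  by rewrite (le_lt_trans qa ay') ltNge (ltW (le_lt_trans qa ay')).
have bp : ~~ (val p < val b).
  by apply/negP => pb; apply: (gap p); rewrite ?pb ?(lt_trans ax).
have bq : val b' <= val q by rewrite leNgt -(S4 _ _ _ _ Spq Sb).
by rewrite (lt_le_trans yb' bq) ltNge (ltW (lt_le_trans yb' bq)).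
Qed.

(** A critical point from [x] to [x'] also separates [y] from [y']. Without one, both pairs lie in
    corresponding gaps, where [f] and [g] are monotone in the same direction because their end
    values agree. *)
Lemma matched_lt x y x' y' : matched f g S x y -> matched f g S x' y' ->
  val x < val x' -> val y < val y'.
Proof.
have [S1 S2 S3 S4] := fgS; move=> [fxy Mxy] [fxy' Mxy'] xx'.
have [[p [cp xp px']]|nocrit] :=
    pselect (exists p, [/\ critical f p, val x <= val p & val p <= val x']).
  have [q Spq] := S2 _ cp; have [e1 e2] := Mxy _ _ Spq; have [e3 e4] := Mxy' _ _ Spq.
  have yq : val y <= val q by rewrite leNgt -e1 -leNgt.
  have qy' : val q <= val y' by rewrite leNgt -e4 -leNgt.
  rewrite lt_neqAle (le_trans yq qy') andbT; apply/eqP => yy'.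
  have {}yq : val y = val q by apply/eqP; rewrite eq_le yq yy'.
  rewrite yq ltxx in e2; rewrite -yy' yq ltxx in e3.
  move: e2 e3 => /negbT; rewrite -leNgt => px /negbT; rewrite -leNgt => x'p.
  by have := le_lt_trans (le_trans x'p px) xx'; rewrite ltxx.
have [_ fin_f _ m0 m1] := nf.
have ncx : ~ critical f x by move=> cx; apply: nocrit; exists x; rewrite lexx ltW.
have [a [b [ca cb /andP[ax xb] gap]]] := critical_neighbours fin_f m0 m1 ncx.
have x'b : val x' < val b.
  by rewrite ltNge; apply/negP => bx'; apply: nocrit; exists b; rewrite (ltW xb).
have [a' Sa] := S2 _ ca; have [b' Sb] := S2 _ cb.
have [_ _ fa] := S1 _ _ Sa; have [_ _ fb] := S1 _ _ Sb.
have gap' := matching_gap Sa Sb gap.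
have ay : val a' < val y by rewrite -(Mxy _ _ Sa).1 ax.
have yb' : val y' < val b' by rewrite -(Mxy' _ _ Sb).2 x'b.
have yb : val y < val b' by rewrite -(Mxy _ _ Sb).2 xb.
have ay' : val a' < val y' by rewrite -(Mxy' _ _ Sa).1 (lt_trans ax).
case: (ltgtP (val y) (val y')) => [//|yy'|/val_inj yy'].
  case: (leP (f a) (f b)) => [fab|/ltW fab].
    have := gap_increasing cf inj_f gap fab (ltW ax) xx' (ltW x'b).
    rewrite fa fb in fab.
    have := gap_increasing cg inj_g gap' fab (ltW ay') yy' (ltW yb).
    by rewrite -fxy -fxy' => /lt_trans h /h; rewrite ltxx.
  have := gap_decreasing cf inj_f gap fab (ltW ax) xx' (ltW x'b).
  rewrite fa fb in fab.
  have := gap_decreasing cg inj_g gap' fab (ltW ay') yy' (ltW yb).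
  by rewrite -fxy -fxy' => /lt_trans h /h; rewrite ltxx.
have fxx : f x = f x' by rewrite fxy fxy' yy'.
case: (leP (f a) (f b)) => [fab|/ltW fab].
  by have := gap_increasing cf inj_f gap fab (ltW ax) xx' (ltW x'b); rewrite fxx ltxx.
by have := gap_decreasing cf inj_f gap fab (ltW ax) xx' (ltW x'b); rewrite fxx ltxx.
Qed.

End matching.

Lemma matched_sym (R : realType) (f g : unitI R -> R) S x y :
  matched f g S x y -> matched g f (fun q p => S p q) y x.
Proof. by move=> [fxy M]; split=> // q p /M[-> ->]. Qed.

Lemma matching_graph_equiv (R : realType) (f g : unitI R -> R) S :
  nice f -> nice g -> critical_matching f g S -> graph_equiv f g.
Proof.
move=> nf ng fgS; have gfS := critical_matching_sym fgS.
have ex_phi x : {y | matched f g S x y} by apply: cid; exact: matched_exists.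
have ex_psi y : {x | matched f g S x y}.
  apply: cid; have [x /matched_sym M] := matched_exists ng nf gfS y.
  by exists x.
pose phi x := sval (ex_phi x); pose psi y := sval (ex_psi y).
have phiP x : matched f g S x (phi x) by exact: svalP (ex_phi x).
have psiP y : matched f g S (psi y) y by exact: svalP (ex_psi y).
have lt1 x y x' y' := @matched_lt R f g S nf ng fgS x y x' y'.
have lt2 x y x' y' (M : matched f g S x y) (M' : matched f g S x' y') :
    val y < val y' -> val x < val x'.
  by apply: (matched_lt ng nf gfS); exact: matched_sym.
(* [phi] and [psi] are chosen independently; a strict inequality between [psi (phi x)] and [x], both
   matched with [phi x], would contradict [lt1]. *)
have phiK : cancel phi psi.
  move=> x; apply: val_inj; case: (ltgtP (val (psi (phi x))) (val x)) => // h.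
    by have := lt1 _ _ _ _ (psiP (phi x)) (phiP x) h; rewrite ltxx.
  by have := lt1 _ _ _ _ (phiP x) (psiP (phi x)) h; rewrite ltxx.
have psiK : cancel psi phi.
  move=> y; apply: val_inj; case: (ltgtP (val (phi (psi y))) (val y)) => // h.
    by have := lt2 _ _ _ _ (phiP (psi y)) (psiP y) h; rewrite ltxx.
  by have := lt2 _ _ _ _ (psiP y) (phiP (psi y)) h; rewrite ltxx.
have phi_lt : {homo phi : x y / val x < val y} by move=> x y; exact: lt1.
have psi_lt : {homo psi : x y / val x < val y} by move=> x y; exact: lt2.
exists phi; split => //.
  exists psi; split=> //; first exact: increasing_bijection_continuous phiK psiK.
  exact: increasing_bijection_continuous psiK phiK.
by apply/funext => x; case: (phiP x).
Qed.

(** * Isomorphisms match critical points *)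

Section height_preserving_homeomorphism.
Variables (R : realType) (f g : unitI R -> R).
Hypotheses (nf : nice f) (ng : nice g).
Variables (h : tree_space f -> tree_space g) (k : tree_space g -> tree_space f).
Hypotheses (ch : continuous h) (ck : continuous k).
Hypotheses (hk : cancel h k) (kh : cancel k h).
Hypothesis hh : forall c, tree_height (h c) = tree_height c.

Let kk u : tree_height (k u) = tree_height u.
Proof. by rewrite -[in RHS](kh u) hh. Qed.

Let below_h c d : below (T := merge_tree_of f) c d ->
  below (T := merge_tree_of g) (h c) (h d).
Proof. exact: (@below_homeo R (merge_tree_of f) (merge_tree_of g) h). Qed.

Let below_k c d : below (T := merge_tree_of g) c d ->
  below (T := merge_tree_of f) (k c) (k d).
Proof. exact: (@below_homeo R (merge_tree_of g) (merge_tree_of f) k). Qed.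

Lemma vertices_homeo c : tree_vertices c -> tree_vertices (h c).
Proof.
have [cf finf injf f0 f1] := nf; have [cg fing injg g0 g1] := ng.
move=> /(vertex_below cf finf injf f0 f1) Vc.
apply/(vertex_below cg fing injg g0 g1); case: Vc => [cmin|].
  left=> d /below_k; rewrite hk => /cmin kd.
  by rewrite -kd kh.
move=> [d [d' [dc d'c nd nd' cjoin]]]; right; exists (h d), (h d'); split.
- exact: below_h.
- exact: below_h.
- by move=> /(can_inj hk).
- by move=> /(can_inj hk).
- move=> e /below_k + /below_k; rewrite !hk => de d'e.
  by have := cjoin _ de d'e; rewrite kk hh.
Qed.

(** The upward branch from a vertex has a single point at each height, and [h] preserves both order
    and height. *)
Lemma homeo_tpoint p q s : f p <= s -> h (tpoint f p (f p)) = tpoint g q (g q) ->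
  h (tpoint f p s) = tpoint g q s.
Proof.
have [cf _ _ _ _] := nf; have [cg _ _ _ _] := ng.
move=> ps hpq; have pq : f p = g q.
  by have := hh (tpoint f p (f p)); rewrite hpq !height_tpoint.
have : below (T := merge_tree_of f) (tpoint f p (f p)) (tpoint f p s).
  by apply/(below_tpoint cf); rewrite // seg_max_id.
move=> /below_h; rewrite hpq.
have hs : tree_height (h (tpoint f p s)) = s by rewrite hh height_tpoint.
rewrite -(tpoint_base (h (tpoint f p s))) hs.
have bs : g (base (h (tpoint f p s))) <= s by rewrite -{2}hs le_base.
move=> /(below_tpoint cg (lexx _) bs)[_ m].
by apply/(eq_tpoint cg); rewrite // -?pq // seg_max_sym.
Qed.

End height_preserving_homeomorphism.

Lemma edges_homeo (R : realType) (f g : unitI R -> R)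
    (h : tree_space f -> tree_space g) (k : tree_space g -> tree_space f) :
  continuous h -> continuous k -> cancel h k -> cancel k h ->
  (forall c, tree_vertices c -> tree_vertices (h c)) ->
  (forall c, tree_vertices c -> tree_vertices (k c)) ->
  forall e, tree_edges e -> tree_edges (h @` e).
Proof.
move=> ch ck hk kh hV kV _ [c nVc <-]; exists (h c) => /=.
  by move=> /kV; rewrite hk.
rewrite (connected_component_homeo ch ck hk kh (B := ~` @tree_vertices R g)) // => d.
split; first by apply: contra_not => /kV; rewrite hk.
by apply: contra_not => /hV.
Qed.

Section isomorphism_critical.
Variables (R : realType) (f g : unitI R -> R).
Hypotheses (nf : nice f) (ng : nice g).
Variables (h : tree_space f -> tree_space g) (k : tree_space g -> tree_space f).
Hypotheses (ch : continuous h) (ck : continuous k).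
Hypotheses (hk : cancel h k) (kh : cancel k h).
Hypothesis hh : forall c, tree_height (h c) = tree_height c.
Hypothesis hl : forall v e, tree_vertices v ->
  child_edges (T := merge_tree_of f) v e ->
  tree_label (h v : merge_tree_of g) (h @` e) = tree_label v e.

Let kk u : tree_height (k u) = tree_height u.
Proof. by rewrite -[in RHS](kh u) hh. Qed.

Let hV c := @vertices_homeo R f g nf ng h k ch ck hk kh hh c.
Let kV c := @vertices_homeo R g f ng nf k h ck ch kh hk kk c.

Lemma iso_child_edges v e : child_edges (T := merge_tree_of f) v e ->
  child_edges (T := merge_tree_of g) (h v) (h @` e).
Proof.
apply: (@child_edges_homeo R (merge_tree_of f) (merge_tree_of g) h k) => //.
exact: edges_homeo hV kV.
Qed.

Definition same_vertex p q :=
  [/\ critical f p, critical g q & h (tpoint f p (f p)) = tpoint g q (g q)].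

(** The label of the child edge of [r] over [p] records the side of [p]; the image of this edge is a
    child edge of [r'] over [p'] with the same label. *)
Lemma same_vertex_side p r p' r' : same_vertex p p' -> same_vertex r r' ->
  f p < f r -> forall cf : continuous f, seg_max cf p r <= f r ->
  (val p < val r -> val p' < val r') /\ (val r < val p -> val r' < val p').
Proof.
move=> [cp cp' pE] [cr cr' rE] pr cf mpr.
have [_ finf injf f0 f1] := nf; have [cg fing injg g0 g1] := ng.
have [e [s [he ps es]]] := edge_above finf injf f0 f1 cr pr mpr.
have side := label_side cf finf injf f0 f1 cr he (es : e (tree_proj (epi_point f p s))).
have := iso_child_edges he; rewrite rE => he'.
have he's : (h @` e) (tree_proj (epi_point g p' s)).
  exists (tpoint f p s) => //.
  exact: (homeo_tpoint nf ng ch hh ps pE).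
have side' := label_side cg fing injg g0 g1 cr' he' he's.
have := hl (vertex_tpoint cr) he; rewrite rE => lE; rewrite lE in side'.
move: side side'; rewrite /=; case: tree_label => /= a b; split=> // c.
  by have := lt_trans a c; rewrite ltxx.
by have := lt_trans a c; rewrite ltxx.
Qed.

Lemma same_vertex_lt p q p' q' : same_vertex p q -> same_vertex p' q' ->
  val p < val p' -> val q < val q'.
Proof.
have [cf _ injf _ _] := nf; move=> Spq Spq' pp'.
have [cp _ _] := Spq; have [cp' _ _] := Spq'.
have npp : p <> p' by move=> h'; rewrite h' ltxx in pp'.
case: (segment_max_cases cf p p') => [m|[m|[z [zb zp zp' cz zE]]]].
- have p'p : f p' < f p.
    rewrite lt_neqAle -[leRHS]m le_seg_max_r andbT; apply/eqP => h'; apply: npp.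
    exact: injf.
  have mm : seg_max cf p' p <= f p by rewrite seg_max_sym m.
  by have [_] := same_vertex_side Spq' Spq p'p mm; apply.
- have p'p : f p < f p'.
    rewrite lt_neqAle -[leRHS]m le_seg_max_l andbT; apply/eqP => h'; apply: npp.
    exact: injf.
  have mm : seg_max cf p p' <= f p' by rewrite m.
  by have [+ _] := same_vertex_side Spq Spq' p'p mm; apply.
have [_ fing injg g0 g1] := ng.
have [z' Szz] : exists z', same_vertex z z'.
  have /vertexP[z' cz' zE'] := hV (vertex_tpoint cz).
  by exists z'.
have pz : f p < f z.
  by rewrite lt_neqAle zE le_seg_max_l andbT -zE; apply/eqP => h'; apply: zp; exact: injf.
have p'z : f p' < f z.
  by rewrite lt_neqAle zE le_seg_max_r andbT -zE; apply/eqP => h'; apply: zp'; exact: injf.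
have /andP[pz' zp''] : val p < val z < val p'.
  case/betweenE: zb => /andP[a b]; last by have := le_trans a b; rewrite leNgt pp'.
  by rewrite (unitI_lt (nesym zp) a) (unitI_lt zp' b).
have mpz : seg_max cf p z <= f z by rewrite zE; exact: seg_max_between.
have mp'z : seg_max cf p' z <= f z.
  by rewrite zE (seg_max_sym _ p p'); apply: seg_max_between; rewrite betweenC.
have [+ _] := same_vertex_side Spq Szz pz mpz => /(_ pz') qz.
have [_ +] := same_vertex_side Spq' Szz p'z mp'z => /(_ zp'') zq.
exact: lt_trans zq.
Qed.

End isomorphism_critical.

Lemma chiral_iso_graph_equiv (R : realType) (f g : unitI R -> R) :
  nice f -> nice g ->
  chiral_iso (chiral_merge_tree_of f) (chiral_merge_tree_of g) -> graph_equiv f g.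
Proof.
move=> nf ng [h [[k [ch ck hk kh]] hh hl]].
have kk u : tree_height (k u) = tree_height u by rewrite -[in RHS](kh u); exact/esym/hh.
have hV := @vertices_homeo R f g nf ng h k ch ck hk kh hh.
have kV := @vertices_homeo R g f ng nf k h ck ch kh hk kk.
(* The inverse preserves labels as well, which gives the converse comparison in the last clause of
   [critical_matching]. *)
have kl v e : tree_vertices v -> child_edges (T := merge_tree_of g) v e ->
    tree_label (k v : merge_tree_of f) (k @` e) = tree_label v e.
  move=> Vv he; have he' := @iso_child_edges R g f ng nf k h ck ch kh hk kk v e he.
  have := hl (k v) (k @` e) (kV _ Vv) he'.
  rewrite image_comp (_ : h \o k = id); last by apply/funext => u; exact: kh.
  by rewrite image_id kh => /= ->.
apply: (@matching_graph_equiv R f g (same_vertex h)) => //; split.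
- move=> p q [cp cq hpq]; split=> //.
  have [cf _ _ _ _] := nf; have [cg _ _ _ _] := ng.
  by have := hh (tpoint f p (f p)); rewrite hpq /= !height_tpoint.
- move=> p cp; have /vertexP[q cq qE] := hV _ (vertex_tpoint cp).
  by exists q.
- move=> q cq; have /vertexP[p cp pE] := kV _ (vertex_tpoint cq).
  by exists p; split=> //; rewrite -pE kh.
- move=> p q p' q' S S'; apply/idP/idP.
    exact: (same_vertex_lt nf ng ch ck hk kh hh hl S S').
  have Sk a b : same_vertex h a b -> same_vertex k b a.
    by move=> [ca cb ab]; split=> //; rewrite -ab hk.
  exact: (same_vertex_lt ng nf ck ch kh hk kk kl (Sk _ _ S) (Sk _ _ S')).
Qed.

(** * Graph-equivalences induce isomorphisms *)

Lemma graph_equiv_inverse (R : realType) (f g : unitI R -> R) : graph_equiv f g ->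
  exists phi psi : unitI R -> unitI R,
    [/\ continuous phi /\ continuous psi, cancel phi psi /\ cancel psi phi,
        {homo phi : x y / val x < val y}, {homo psi : x y / val x < val y} &
        (forall x, f x = g (phi x)) /\ (forall y, g y = f (psi y))].
Proof.
move=> [phi [[psi [cphi cpsi phiK psiK]] phi_lt fE]].
exists phi, psi; split=> //.
  move=> x y xy; case: (ltgtP (val (psi x)) (val (psi y))) => // [/phi_lt|/val_inj h].
    by rewrite !psiK ltNge ltW.
  by move: xy; rewrite -(psiK x) h psiK ltxx.
by split=> [x|y]; rewrite fE //= psiK.
Qed.

Lemma graph_equiv_refl (R : realType) (f : unitI R -> R) : graph_equiv f f.
Proof. by exists id; split => //; exists id; split => //; move=> x; exact: cvg_id. Qed.

Lemma graph_equiv_sym (R : realType) (f g : unitI R -> R) :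
  graph_equiv f g -> graph_equiv g f.
Proof.
move=> /graph_equiv_inverse[phi [psi [[cphi cpsi] [phiK psiK] _ psi_lt [_ gE]]]].
by exists psi; split=> //; [exists phi|exact/funext].
Qed.

Lemma graph_equiv_trans (R : realType) (f g h : unitI R -> R) :
  graph_equiv f g -> graph_equiv g h -> graph_equiv f h.
Proof.
move=> [phi [[psi [cphi cpsi phiK psiK]] phi_lt ->]].
move=> [phi' [[psi' [cphi' cpsi' phiK' psiK']] phi_lt' ->]].
exists (phi' \o phi); split => //; last by move=> x y /phi_lt/phi_lt'.
exists (psi \o psi'); split.
- by move=> x; apply: continuous_comp; [exact: cphi|exact: cphi'].
- by move=> x; apply: continuous_comp; [exact: cpsi'|exact: cpsi].
- exact: can_comp.
- exact: can_comp.
Qed.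

Section reparametrization.
Variables (R : realType) (f g : unitI R -> R).
Hypotheses (cf : continuous f) (cg : continuous g).
Variables (phi psi : unitI R -> unitI R).
Hypotheses (cphi : continuous phi) (cpsi : continuous psi).
Hypotheses (phiK : cancel phi psi) (psiK : cancel psi phi).
Hypothesis phi_lt : {homo phi : x y / val x < val y}.
Hypothesis psi_lt : {homo psi : x y / val x < val y}.
Hypothesis fE : forall x, f x = g (phi x).

Let phi_le x y : (val (phi x) <= val (phi y)) = (val x <= val y).
Proof.
rewrite !leNgt; congr (~~ _); apply/idP/idP; last exact: phi_lt.
by move=> /psi_lt; rewrite !phiK.
Qed.

Lemma reparam_seg_max x y : seg_max cg (phi x) (phi y) = seg_max cf x y.
Proof.
have btw z : between (phi x) (phi y) (phi z) <-> between x y z.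
  by rewrite !betweenE !phi_le.
apply/eqP; rewrite eq_le; apply/andP; split; apply/seg_max_le => z.
  by rewrite -(psiK z) => /btw /(le_seg_max cf); rewrite fE.
by move=> /btw /(le_seg_max cg); rewrite fE.
Qed.

Lemma reparam_critical p : critical f p -> critical g (phi p).
Proof.
case=> h; [left|right].
  have nh : nbhs (psi (phi p)) [set x | f p <= f x] by rewrite phiK.
  apply: (@filterS _ (nbhs (phi p)) _ _ _ _ (@cpsi (phi p) _ nh)) => y.
  by rewrite /preimage /mkset !fE psiK.
have nh : nbhs (psi (phi p)) [set x | f x <= f p] by rewrite phiK.
apply: (@filterS _ (nbhs (phi p)) _ _ _ _ (@cpsi (phi p) _ nh)) => y.
by rewrite /preimage /mkset !fE psiK.
Qed.

Definition reparam (c : tree_space f) : tree_space g :=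
  tpoint g (phi (base c)) (tree_height c).

(** Independence of the representative, because [phi] preserves [seg_max]. *)
Lemma reparam_tpoint x t : f x <= t -> reparam (tpoint f x t) = tpoint g (phi x) t.
Proof.
move=> xt; rewrite /reparam height_tpoint //; apply/(eq_tpoint cg).
- by rewrite -fE; have := le_base (tpoint f x t); rewrite height_tpoint.
- by rewrite -fE.
- by rewrite reparam_seg_max seg_max_sym base_tpoint.
Qed.

Lemma reparam_height c : tree_height (reparam c) = tree_height c.
Proof. by rewrite height_tpoint // -fE le_base. Qed.

Lemma reparam_vertices c : tree_vertices c -> tree_vertices (reparam c).
Proof.
move=> /vertexP[p cp ->]; rewrite reparam_tpoint // fE; apply: vertex_tpoint.
exact: reparam_critical.
Qed.

(** Along [reparam] the height is unchanged, and [join] at [y] becomes [join] at [psi y]. *)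
Lemma continuous_reparam : continuous reparam.
Proof.
apply: (@continuous_to_tree _ _ cg) => [|y].
  rewrite (_ : _ \o _ = @tree_height R f); first exact: continuous_height.
  by apply/funext => c; exact: reparam_height.
rewrite (_ : _ \o _ = join cf (psi y)); first exact: continuous_join.
apply/funext => c; rewrite /= join_tpoint; last by rewrite -fE le_base.
by rewrite -[in LHS](psiK y) reparam_seg_max.
Qed.

End reparametrization.

Section reparametrization_iso.
Variables (R : realType) (f g : unitI R -> R).
Hypotheses (cf : continuous f) (cg : continuous g).
Variables (phi psi : unitI R -> unitI R).
Hypotheses (cphi : continuous phi) (cpsi : continuous psi).
Hypotheses (phiK : cancel phi psi) (psiK : cancel psi phi).
Hypothesis phi_lt : {homo phi : x y / val x < val y}.
Hypothesis psi_lt : {homo psi : x y / val x < val y}.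
Hypotheses (fE : forall x, f x = g (phi x)) (gE : forall y, g y = f (psi y)).

Local Notation h := (@reparam R f g phi).
Local Notation k := (@reparam R g f psi).

Lemma reparamK : cancel h k.
Proof.
move=> c; rewrite -{1}(tpoint_base c).
rewrite (reparam_tpoint cf cg phiK psiK phi_lt psi_lt fE (le_base c)).
rewrite (reparam_tpoint cg cf psiK phiK psi_lt phi_lt gE) -?fE ?le_base //.
by rewrite phiK tpoint_base.
Qed.

End reparametrization_iso.

Section reparametrization_label.
Variables (R : realType) (f g : unitI R -> R).
Hypotheses (cf : continuous f) (cg : continuous g).
Variables (phi psi : unitI R -> unitI R).
Hypotheses (cphi : continuous phi) (cpsi : continuous psi).
Hypotheses (phiK : cancel phi psi) (psiK : cancel psi phi).
Hypothesis phi_lt : {homo phi : x y / val x < val y}.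
Hypothesis psi_lt : {homo psi : x y / val x < val y}.
Hypotheses (fE : forall x, f x = g (phi x)) (gE : forall y, g y = f (psi y)).

Local Notation h := (@reparam R f g phi).
Local Notation k := (@reparam R g f psi).

Let hk : cancel h k := reparamK cf cg phiK psiK phi_lt psi_lt fE gE.
Let kh : cancel k h := reparamK cg cf psiK phiK psi_lt phi_lt gE fE.
Let ch : continuous h := continuous_reparam cf cg phiK psiK phi_lt psi_lt fE.
Let ck : continuous k := continuous_reparam cg cf psiK phiK psi_lt phi_lt gE.
Let hh c : tree_height (h c) = tree_height c := reparam_height cg fE c.
Let hV c := @reparam_vertices R f g cf cg phi psi cpsi phiK psiK phi_lt psi_lt fE c.
Let kV c := @reparam_vertices R g f cg cf psi phi cphi psiK phiK psi_lt phi_lt gE c.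

Lemma reparam_child_edges v e : child_edges (T := merge_tree_of f) v e ->
  child_edges (T := merge_tree_of g) (h v) (h @` e).
Proof.
apply: (@child_edges_homeo R (merge_tree_of f) (merge_tree_of g) h k) => //.
exact: edges_homeo hV kV.
Qed.

Lemma reparam_left_of (e e' : set (merge_tree_of f)) :
  left_of e e' -> left_of (f := g) (h @` e) (h @` e').
Proof.
move=> lo z w hz hw.
have pull (u : epigraph g) (d : set (tree_space f)) : (h @` d) (tree_proj u) ->
    d (tree_proj (epi_point f (psi (val u).1) (val u).2)).
  move=> [c dc cE]; rewrite -[tree_proj _]/(tpoint f _ _).
  rewrite -(reparam_tpoint cg cf psiK phiK psi_lt phi_lt gE); last by have := set_valP u.
  by rewrite -projE -cE hk.
have /phi_lt := lo _ _ (pull _ _ hz) (pull _ _ hw).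
by rewrite /= !psiK.
Qed.

Lemma reparam_left v e :
  (exists e', child_edges (T := merge_tree_of f) v e' /\ left_of e e') ->
  exists e', child_edges (T := merge_tree_of g) (h v) e' /\ left_of (h @` e) e'.
Proof.
move=> [e' [he' lo]]; exists (h @` e'); split; first exact: reparam_child_edges.
exact: reparam_left_of.
Qed.

End reparametrization_label.

Lemma graph_equiv_tree (R : realType) (f g : unitI R -> R) : nice f -> nice g ->
  graph_equiv f g ->
  exists h : tree_space f -> tree_space g,
  [/\ homeomorphism h, forall c, tree_height (h c) = tree_height c,
      forall v, tree_vertices v -> tree_vertices (h v),
      forall v e, child_edges (T := merge_tree_of f) v e ->
        child_edges (T := merge_tree_of g) (h v) (h @` e) &
      forall v e, tree_label (h v : merge_tree_of g) (h @` e) =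
        tree_label (v : merge_tree_of f) e].
Proof.
move=> [cf _ _ _ _] [cg _ _ _ _] /graph_equiv_inverse.
move=> [phi [psi [[cphi cpsi] [phiK psiK] phi_lt psi_lt [fE gE]]]].
have hk := reparamK cf cg phiK psiK phi_lt psi_lt fE gE.
have kh := reparamK cg cf psiK phiK psi_lt phi_lt gE fE.
exists (@reparam R f g phi); split.
- exists (@reparam R g f psi); split=> //.
    exact: (continuous_reparam cf cg phiK psiK phi_lt psi_lt fE).
  exact: (continuous_reparam cg cf psiK phiK psi_lt phi_lt gE).
- exact: reparam_height.
- exact: (reparam_vertices cf cg cpsi phiK psiK phi_lt psi_lt fE).
- exact: (reparam_child_edges cf cg cphi cpsi phiK psiK phi_lt psi_lt fE gE).
- move=> v e; rewrite /tree_label; congr (if _ then _ else _); apply/asbool_equiv_eq.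
  split; last exact: (reparam_left cf cg cphi cpsi phiK psiK phi_lt psi_lt fE gE).
  move=> /(reparam_left cg cf cpsi cphi psiK phiK psi_lt phi_lt gE fE).
  rewrite image_comp (_ : _ \o _ = id); last by apply/funext => c; exact: hk.
  by rewrite image_id hk.
Qed.


Lemma path_lt_gap (R : realType) (s : seq R) (a r : R) : path <%R a s ->
  a < r < last a s -> r \notin s -> exists i, (i < size s)%N /\
  nth 0 (a :: s) i < r < nth 0 (a :: s) i.+1.
Proof.
elim: s a => [|b s IH] a /=; first by move=> _ /andP[/lt_trans h /h]; rewrite ltxx.
move=> /andP[ab sb] /andP[ar rl]; rewrite in_cons negb_or => /andP[rb rs].
case: (ltgtP r b) rb => // h _; first by exists 0%N; rewrite /= ar.
have [|i [si ri]] := IH b sb _ rs; first by rewrite h.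
by exists i.+1.
Qed.

(** Every critical point is a breakpoint: inside a linear piece it would force slope zero, and then
    a whole interval of critical points would share one value. *)
Lemma piecewise_linear_critical (R : realType) (g : unitI R -> R) :
  piecewise_linear g ->
  (forall p q, critical g p -> critical g q -> p <> q -> g p <> g q) ->
  finite_set (critical g).
Proof.
move=> [s [[sorted_s /eqP s1] lin]] dist.
apply: (@sub_finite_set _ _ ((@clampI R) @` [set` (0 : R) :: s])); last first.
  exact/finite_image/finite_seq.
move=> x cx; exists (val x); last exact: clampI_val.
apply: contrapT => nx; have : val x \notin 0 :: s by apply/negP.
rewrite in_cons negb_or => /andP[x0 xs].
have x01 : 0 < val x < last 0 s.
  rewrite s1 !lt_neqAle eq_sym x0 unitI_ge0 unitI_le1 !andbT andTb.
  apply/eqP => x1; move: xs; rewrite x1 -s1.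
  have s0 : s != [::].
    by apply/eqP => s0; move: s1; rewrite s0 /= => /esym/eqP; rewrite oner_eq0.
  by case: (s) s0 => //= b t _; rewrite mem_last.
have [i [si /andP[ix xi]]] := path_lt_gap sorted_s x01 xs.
have [a [b gE]] := lin _ si.
set l := nth 0 (0 :: s) i in ix gE; set u := nth 0 (0 :: s) i.+1 in xi gE.
have e0 : 0 < Num.min (val x - l) (u - val x) by rewrite lt_min !subr_gt0 ix.
have inside (y : unitI R) : `|val x - val y| < Num.min (val x - l) (u - val x) ->
    l < val y < u.
  by rewrite lt_min !ltr_norml => h; order_lra.
have gy (y : unitI R) : l < val y < u -> g y = a * val y + b.
  by move=> /andP[ly yu]; apply: gE; rewrite !ltW.
have gx := gy x; rewrite ix xi in gx; have {}gx := gx isT.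
have x1 : val x < 1 by rewrite -s1; case/andP: x01.
have x0' : 0 < val x by case/andP: x01.
have near_points (P : set (unitI R)) : nbhs x P -> exists y z,
    [/\ P y /\ P z, val y < val x, val x < val z, l < val y < u & l < val z < u].
  move=> /nbhs_unitIP[e' e'0 eP].
  have m0 : 0 < Num.min e' (Num.min (val x - l) (u - val x)) by rewrite lt_min e'0.
  have [y [yx]] := near_left_point m0 x0'; rewrite lt_min => /andP[/eP Py /inside iy].
  have [z [xz]] := near_right_point m0 x1; rewrite lt_min => /andP[/eP Pz /inside iz].
  by exists y, z.
(* With a nonzero slope one neighbour of [x] has a larger and the other a smaller value. *)
have a0 : a = 0.
  have flat (y z : unitI R) : val y < val x -> val x < val z ->
      l < val y < u -> l < val z < u ->
      g x <= g y /\ g x <= g z \/ g y <= g x /\ g z <= g x -> a = 0.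
    move=> yx xz /gy -> /gy ->; rewrite gx !lerD2r.
    case: (ltgtP a 0) => // a0.
      by rewrite !ler_nM2l // !leNgt yx xz => -[[]|[]].
    by rewrite !ler_pM2l // !leNgt yx xz => -[[]|[]].
  case: cx => /near_points[y [z [[hy hz] yx xz iy iz]]].
    by apply: (flat y z) => //; left.
  by apply: (flat y z) => //; right.
have [y [_ [_ yx _ iy _]]] := near_points setT (@filterT _ (nbhs x) _).
apply: (dist x y) => //.
- left; apply/nbhs_unitIP; exists (Num.min (val y - l) (u - val y)).
    by case/andP: iy => ly yu; rewrite lt_min !subr_gt0 ly.
  move=> z yz; have iz : l < val z < u.
    move: yz; rewrite lt_min !ltr_norml !opprB.
    by rewrite !ltrD2l !ltrN2 => /andP[/andP[_ ->] /andP[->]].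
  by rewrite !gy // a0 !mul0r.
- by move=> xy; rewrite xy ltxx in yx.
- by rewrite gx gy // a0 !mul0r.
Qed.

Lemma admissible_nice (R : realType) (f : unitI R -> R) : admissible f -> nice f.
Proof.
move=> [[cf [g [fg lin _ dist]]] f0 f1].
have [phi [psi [[cphi cpsi] [phiK psiK] phi_lt psi_lt [fE gE]]]] := graph_equiv_inverse fg.
have fg_critical p := reparam_critical cpsi phiK psiK fE (p := p).
split=> //.
  apply: (@sub_finite_set _ _ (psi @` critical g)).
    by move=> p /fg_critical cp; exists (phi p).
  exact/finite_image/(piecewise_linear_critical lin dist).
move=> p q /fg_critical cp /fg_critical cq; rewrite !fE => pq.
apply: (can_inj phiK); apply: contrapT => npq.
exact: dist npq pq.
Qed.

Lemma nice_tree_is_chiral (R : realType) (f : unitI R -> R) :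
  nice f -> is_chiral_merge_tree (chiral_merge_tree_of f).
Proof. by move=> [cf finf injf f0 f1]; exact: tree_is_chiral. Qed.

(** * Isomorphism classes and the bijection *)

Lemma chiral_iso_refl (R : realType) (T : chiral_data R) : chiral_iso T T.
Proof.
exists id; split=> //; last by move=> v e _ _; rewrite image_id.
by exists id; split=> // x; exact: cvg_id.
Qed.

Lemma graph_equiv_iso_class (R : realType) (f g : unitI R -> R) :
  nice f -> nice g -> graph_equiv f g ->
  iso_class (chiral_merge_tree_of f) = iso_class (chiral_merge_tree_of g).
Proof.
suff sub (f' g' : unitI R -> R) Y : nice f' -> nice g' -> graph_equiv f' g' ->
    iso_class (chiral_merge_tree_of g') Y -> iso_class (chiral_merge_tree_of f') Y.
  move=> nf ng fg; apply/funext => Y; apply/propext; split; last exact: sub.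
  exact/sub/graph_equiv_sym.
move=> nf ng fg [Ych [h [[k [ch ck hk kh]] hh hl]]]; split=> //.
have [h' [[k' [ch' ck' hk' kh']] hh' hV' hE' hl']] := graph_equiv_tree nf ng fg.
exists (h \o h'); split.
- exists (k' \o k); split.
  + by move=> x; apply: continuous_comp; [exact: ch'|exact: ch].
  + by move=> x; apply: continuous_comp; [exact: ck|exact: ck'].
  + exact: can_comp.
  + exact: can_comp.
- by move=> x; rewrite /= hh; exact: hh'.
- move=> v e Vv he; rewrite -image_comp.
  rewrite (hl (h' v) (h' @` e)); [exact: hl'|exact: hV'|exact: hE'].
Qed.

Lemma iso_class_graph_equiv (R : realType) (f g : unitI R -> R) :
  nice f -> nice g ->
  iso_class (chiral_merge_tree_of f) = iso_class (chiral_merge_tree_of g) ->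
  graph_equiv f g.
Proof.
move=> nf ng fgE; apply: chiral_iso_graph_equiv => //.
have : iso_class (chiral_merge_tree_of g) (chiral_merge_tree_of g).
  by split; [exact: nice_tree_is_chiral|exact: chiral_iso_refl].
by rewrite -fgE => -[].
Qed.

Lemma graph_equiv_function_class (R : realType) (f g : unitI R -> R) :
  graph_equiv f g -> function_class f = function_class g.
Proof.
move=> fg; apply/funext => u; apply/propext; split=> -[au fu]; split=> //.
  exact: graph_equiv_trans (graph_equiv_sym fg) fu.
exact: graph_equiv_trans fg fu.
Qed.

Theorem corollary6p11 (R : realType) :
  (forall f : unitI R -> R, admissible f ->
     is_chiral_merge_tree (chiral_merge_tree_of f)) /\
  exists Psi : ((unitI R -> R) -> Prop) -> (chiral_data R -> Prop),
    [/\ forall C, Mset C -> Xset (Psi C),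
        forall f : unitI R -> R, admissible f ->
          Psi (function_class f) = iso_class (chiral_merge_tree_of f) &
        forall Y, (exists2 C, Mset C & Psi C = Y) ->
          exists! C, Mset C /\ Psi C = Y].
Proof.
split=> [f /admissible_nice|]; first exact: nice_tree_is_chiral.
(* The union of the isomorphism classes over all members of [C], which needs no chosen
   representative; [PsiE] shows that on a function class all these classes coincide. *)
pose Psi (C : (unitI R -> R) -> Prop) (Y : chiral_data R) : Prop :=
  exists2 f, C f & iso_class (chiral_merge_tree_of f) Y.
have PsiE (f : unitI R -> R) : admissible f ->
    Psi (function_class f) = iso_class (chiral_merge_tree_of f).
  move=> af; apply/funext => Y; apply/propext; split=> [[g [ag fg]]|].
    by rewrite -(graph_equiv_iso_class (admissible_nice af) (admissible_nice ag) fg).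
  by exists f => //; split=> //; exact: graph_equiv_refl.
exists Psi; split.
- move=> _ [f af ->]; exists (chiral_merge_tree_of f).
    exact/nice_tree_is_chiral/admissible_nice.
  exact: PsiE.
- exact: PsiE.
- move=> _ [_ [f af ->] <-]; exists (function_class f); split.
    by split=> //; exists f.
  move=> _ [[g ag ->]]; rewrite -!/(function_class _) !PsiE // => gf.
  apply: graph_equiv_function_class; apply: iso_class_graph_equiv => //.
  + exact: admissible_nice.
  + exact: admissible_nice.
Qed.
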